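(* Let $V$ be a simple vertex operator algebra, $G$ a finite group of automorphisms of $V$, $g$ an element of the center of $G$, and assume $V$ is $g$-rational. Let $M$ be an irreducible $g$-twisted $V$-module with $G_M$, $\phi(h)$, $\alpha_M$, $W_\lambda$, $M_\lambda$ as in the context. Then for every irreducible character $\gamma$ of $\mathbb{C}^{\alpha_M}[G_M]$, $M_\gamma$ is an irreducible $V^G$-module, and $M\cong\bigoplus_{\lambda}W_\lambda\otimes M_\lambda$ as $\mathbb{C}^{\alpha_M}[G_M]\otimes V^G$-modules, the sum over all irreducible characters $\lambda$ of $\mathbb{C}^{\alpha_M}[G_M]$.
   Context: For $h\in G$, $M\circ h$ is the space $M$ with vertex operators $Y_{M\circ h}(v,z)=Y_M(hv,z)$; since $g$ is central it is again an irreducible $g$-twisted $V$-module. $G_M=\{h\in G: M\circ h\cong M \text{ as } g\text{-twisted } V\text{-modules}\}$. For each $h\in G_M$ fix a linear isomorphism $\phi(h):M\to M$ with $\phi(h)Y_M(v,z)\phi(h)^{-1}=Y_M(hv,z)$ for all $v\in V$, with $\phi(1)=1_M$; then $\phi(h)\phi(k)=\alpha_M(h,k)\phi(hk)$ for a 2-cocycle $\alpha_M$ with root-of-unity values, and $M$ is a module for the twisted group algebra $\mathbb{C}^{\alpha_M}[G_M]$ (basis $\bar h$, $\bar h\bar k=\alpha_M(h,k)\overline{hk}$) via $\bar h\mapsto\phi(h)$. For an irreducible character $\lambda$ of $\mathbb{C}^{\alpha_M}[G_M]$ with simple module $W_\lambda$ and fixed nonzero $w\in W_\lambda$, $M_\lambda=\{f(w):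 f\in\mathrm{Hom}_{\mathbb{C}^{\alpha_M}[G_M]}(W_\lambda,M)\}\subseteq M$ (every $W_\lambda$ occurs in $M$, so $M_\lambda\ne 0$). $V^G$ is the fixed-point vertex operator subalgebra. $V$ is $g$-rational if every admissible ($\frac1T\mathbb{Z}_+$-graded) $g$-twisted $V$-module is a direct sum of irreducible ones. *)

(* Defs.v *)
From HB Require Import structures.
From mathcomp Require Import all_boot all_order all_algebra all_fingroup all_solvable.
From mathcomp Require Import reals trigo.
From mathcomp Require Import complex.
Set Implicit Arguments.
Unset Strict Implicit.
Unset Printing Implicit Defensive.
Import Order.TTheory GRing.Theory Num.Theory.
Local Open Scope ring_scope.

(* Vertex operators are given by their modes:                                  *)
(*   Y u n w  = u_n w           (n : int)      for V acting on V,              *)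
(*   Ym u k w = u_(k/T) w       (k : int)      for a g-twisted module M,       *)
(* where T = #[g] is the order of g, so modes of twisted modules range over    *)
(* (1/T)Z and are encoded by their numerator k.                               *)

Section VOADefs.
Variable R : realType.
Local Notation C := (complex R).

Definition gbinom (x : C) (i : nat) : C :=
  (\prod_(j < i) (x - j%:R)) / (i`!)%:R.

Definition subspace (W : lmodType C) (P : W -> Prop) :=
  P 0 /\ (forall (a : C) x y, P x -> P y -> P (a *: x + y)).

Definition linmap (W1 W2 : lmodType C) (f : W1 -> W2) :=
  forall (a : C) x y, f (a *: x + y) = a *: f x + f y.

Definition findim (W : lmodType C) (P : W -> Prop) :=
  exists s : seq W, forall v, P v ->
    exists c : nat -> C, v = \sum_(i < size s) c i *: s`_i.

Definition bilin_op (A B : lmodType C) (Y : A -> int -> B -> B) :=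
  (forall n (a : C) u1 u2 w, Y (a *: u1 + u2) n w = a *: Y u1 n w + Y u2 n w) /\
  (forall u n (a : C) w1 w2, Y u n (a *: w1 + w2) = a *: Y u n w1 + Y u n w2).

Definition truncated (A B : lmodType C) (Y : A -> int -> B -> B) :=
  forall u w, exists N : int, forall n : int, N <= n -> Y u n w = 0.

Definition submod_for (A B : lmodType C) (Y : A -> int -> B -> B)
    (S : A -> Prop) (P : B -> Prop) :=
  subspace P /\ forall u n w, S u -> P w -> P (Y u n w).

Section VOA.
Variables (V : lmodType C) (Y : V -> int -> V -> V) (one om : V).

Definition Lop (n : int) (v : V) : V := Y om (n + 1) v.

Definition homog (d : int) (v : V) := Lop 0 v = d%:~R *: v.

(* Borcherds (component form of the Jacobi) identity: since all the          *)
(* (infinite) sums below have only finitely many non-zero terms (truncation), *)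
(* we state that their partial sums eventually agree.                         *)
Definition borcherds :=
  forall (u v w : V) (p q r : int), exists N : nat, forall K : nat, (N <= K)%N ->
    \sum_(i < K) gbinom p%:~R i *: Y (Y u (r + i%:Z) v) (p + q - i%:Z) w =
    \sum_(i < K) ((-1) ^+ i * gbinom r%:~R i) *:
        (Y u (p + r - i%:Z) (Y v (q + i%:Z) w)
         - (-1) ^ r *: Y v (q + r - i%:Z) (Y u (p + i%:Z) w)).

Definition vacuum_axioms :=
  [/\ (forall n w, Y one n w = if n == -1 then w else 0),
      (forall u, Y u (-1) one = u) &
      (forall u (n : int), 0 <= n -> Y u n one = 0)].

Definition virasoro_axiom :=
  exists c : C, forall (m n : int) v,
    Lop m (Lop n v) - Lop n (Lop m v) =
      (m - n)%:~R *: Lop (m + n) v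
      + (if m + n == 0 then ((m ^+ 3 - m)%:~R / 12%:R * c) *: v else 0).

Definition derivative_axiom :=
  forall u n w, Y (Lop (-1) u) n w = - (n%:~R) *: Y u (n - 1) w.

Definition grading_axioms :=
  [/\ (forall v, exists s : seq (int * V),
         (forall x, x \in s -> homog x.1 x.2) /\ v = \sum_(x <- s) x.2),
      (forall d, findim (homog d)) &
      (exists N : int, forall d, d < N -> forall v, homog d v -> v = 0)].

Definition is_VOA :=
  [/\ bilin_op Y /\ truncated Y, vacuum_axioms, borcherds,
      virasoro_axiom /\ derivative_axiom & grading_axioms].

Definition ideal (I : V -> Prop) :=
  subspace I /\ forall u n w, I w -> I (Y u n w) /\ I (Y w n u).

Definition simple_VOA :=
  is_VOA /\ forall I, ideal I -> (forall v, I v -> v = 0) \/ (forall v, I v).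

Definition is_aut (f : V -> V) :=
  [/\ linmap f, bijective f,
      (forall u n v, f (Y u n v) = Y (f u) n (f v)), f one = one & f om = om].

Definition aut_group (gT : finGroupType) (G : {group gT}) (act : gT -> V -> V) :=
  [/\ (forall h, h \in G -> is_aut (act h)),
      (forall v, act 1%g v = v),
      (forall h k v, h \in G -> k \in G -> act (h * k)%g v = act h (act k v)) &
      (forall h, h \in G -> (forall v, act h v = v) -> h = 1%g)].

Definition fixed_pts (gT : finGroupType) (G : {group gT}) (act : gT -> V -> V)
  (v : V) := forall h, h \in G -> act h v = v.

Section Twisted.
Variables (gT : finGroupType) (act : gT -> V -> V) (g : gT).

Definition tord : nat := #[g]%g.

Definition eta : C :=
  Complex (cos (2 * pi / (tord%:R : R))) (- sin (2 * pi / (tord%:R : R))).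

Definition Vr (r : nat) (v : V) := act g v = eta ^+ r *: v.

Section TwMod.
Variables (M : lmodType C) (Ym : V -> int -> M -> M).

(* weak g-twisted V-module; Ym u k = u_(k/T) *)
Definition weak_twisted_module :=
  [/\ bilin_op Ym, truncated Ym,
      (forall (r : nat) u k w, (r < tord)%N -> Vr r u ->
          (k %% (tord%:Z))%Z != r%:Z -> Ym u k w = 0),
      (forall k w, Ym one k w = if k == - (tord%:Z) then w else 0) &
      (* twisted Jacobi identity, component form: for u in V^r, m in r + TZ *)
      (forall (r : nat) u v w (m n p : int), (r < tord)%N -> Vr r u ->
          (m %% (tord%:Z))%Z = r%:Z ->
        exists N : nat, forall K : nat, (N <= K)%N ->
        \sum_(i < K) gbinom (m%:~R / (tord%:R)) i *:
              Ym (Y u (p + i%:Z) v) (m + n - i%:Z * tord%:Z) w =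
        \sum_(i < K) ((-1) ^+ i * gbinom p%:~R i) *:
            (Ym u (m + (p - i%:Z) * tord%:Z) (Ym v (n + i%:Z * tord%:Z) w)
             - (-1) ^ p *: Ym v (n + (p - i%:Z) * tord%:Z)
                            (Ym u (m + i%:Z * tord%:Z) w)))].

(* L(0) on M is the mode omega_1, i.e. index T *)
Definition Lm0 (w : M) : M := Ym om (tord%:Z) w.
Definition Meig (lam : C) (w : M) := Lm0 w = lam *: w.

Definition twisted_module :=
  [/\ weak_twisted_module,
      (forall w, exists s : seq (C * M),
          (forall x, x \in s -> Meig x.1 x.2) /\ w = \sum_(x <- s) x.2),
      (forall lam, findim (Meig lam)) &
      (forall lam, exists N : int, forall n : int, n <= N ->
          forall w, Meig (lam + n%:~R / (tord%:R)) w -> w = 0)].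

Definition irreducible_on (S : V -> Prop) (P : M -> Prop) :=
  [/\ submod_for Ym S P, (exists w, P w /\ w <> 0) &
      forall Q, submod_for Ym S Q -> (forall w, Q w -> P w) ->
        (forall w, Q w -> w = 0) \/ (forall w, P w -> Q w)].

Definition irreducible_twisted_module :=
  twisted_module /\ irreducible_on (fun _ => True) (fun _ => True).

(* admissible g-twisted module: M = (+)_{a in N} M(a/T),                      *)
(* u_(k/T) M(a/T) <= M((a + T wt u - k - T)/T)  (and M(b/T) = 0 for b < 0)    *)
Definition graded_decomp (P : M -> Prop) (Mg : nat -> M -> Prop) :=
  (forall w, P w -> exists (N : nat) (x : nat -> M),
       (forall a, Mg a (x a) /\ P (x a)) /\ w = \sum_(a < N) x a).

Definition admissible (Mg : nat -> M -> Prop) :=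
  [/\ weak_twisted_module,
      (forall a, subspace (Mg a)),
      graded_decomp (fun _ => True) Mg,
      (forall (N : nat) (x : nat -> M), (forall a, Mg a (x a)) ->
          \sum_(a < N) x a = 0 -> forall a, (a < N)%N -> x a = 0) &
      (forall (d : int) u k (a : nat) w, homog d u -> Mg a w ->
          let b := a%:Z + d * tord%:Z - k - tord%:Z in
          if b < 0 then Ym u k w = 0 else Mg `|b|%N (Ym u k w))].

Definition irr_adm_submod (Mg : nat -> M -> Prop) (P : M -> Prop) :=
  [/\ submod_for Ym (fun _ => True) P, graded_decomp P Mg,
      (exists w, P w /\ w <> 0) &
      forall Q, submod_for Ym (fun _ => True) Q -> graded_decomp Q Mg ->
        (forall w, Q w -> P w) ->
        (forall w, Q w -> w = 0) \/ (forall w, P w -> Q w)].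

Definition direct_sum_of (I : eqType) (N : I -> M -> Prop) :=
  (forall w, exists (s : seq I) (x : I -> M),
      (forall i, N i (x i)) /\ w = \sum_(i <- s) x i) /\
  (forall (s : seq I) (x : I -> M), uniq s -> (forall i, N i (x i)) ->
      \sum_(i <- s) x i = 0 -> forall i, i \in s -> x i = 0).

Definition completely_reducible (Mg : nat -> M -> Prop) :=
  exists (I : eqType) (N : I -> M -> Prop),
    (forall i, irr_adm_submod Mg (N i)) /\ direct_sum_of N.

Definition stab_mod (G : {group gT}) (h : gT) :=
  h \in G /\ exists F : M -> M, [/\ linmap F, bijective F &
      forall v k w, F (Ym (act h v) k w) = Ym v k (F w)].

Definition phi_ok (f : M -> M) (h : gT) :=
  [/\ linmap f, bijective f & forall v k w, f (Ym v k w) = Ym (act h v) k (f w)].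

End TwMod.

Definition g_rational :=
  forall (M : lmodType C) (Ym : V -> int -> M -> M) (Mg : nat -> M -> Prop),
    admissible Ym Mg -> completely_reducible Ym Mg.

End Twisted.
End VOA.

(* Modules for the twisted group algebra C^alpha[G_M]: W = 'rV_n, the basis   *)
(* element hbar acting by x |-> x *m A h (so that hbar kbar = alpha(h,k) hk-bar *)
(* means A k *m A h = alpha h k *: A (h*k)).                                   *)
Section TwGrpAlg.
Variables (gT : finGroupType) (GM : gT -> Prop) (alpha : gT -> gT -> C).

Definition tga_mod (n : nat) (A : gT -> 'M[C]_n) :=
  A 1%g = 1%:M /\
  forall h k, GM h -> GM k -> A k *m A h = alpha h k *: A (h * k)%g.

Definition tga_simple (n : nat) (A : gT -> 'M[C]_n) :=
  [/\ tga_mod A, (0 < n)%N &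
      forall U : 'M[C]_n, (forall h, GM h -> (U *m A h <= U)%MS) ->
        (\rank U == 0)%N || row_full U].

Definition tga_iso (n1 n2 : nat) (A1 : gT -> 'M[C]_n1) (A2 : gT -> 'M[C]_n2) :=
  exists (P : 'M[C]_(n1, n2)) (Q : 'M[C]_(n2, n1)),
    [/\ P *m Q = 1%:M, Q *m P = 1%:M &
        forall h, GM h -> A1 h *m P = P *m A2 h].

Definition complete_simples (k : nat) (n : 'I_k -> nat)
    (A : forall j : 'I_k, gT -> 'M[C]_(n j)) :=
  [/\ (forall j, tga_simple (A j)),
      (forall j j', tga_iso (A j) (A j') -> j = j') &
      (forall n' (A' : gT -> 'M[C]_n'), tga_simple A' ->
          exists j, tga_iso A' (A j))].

Variables (M : lmodType C) (phi : gT -> M -> M).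

Definition tga_hom (n : nat) (A : gT -> 'M[C]_n) (f : 'rV[C]_n -> M) :=
  linmap f /\ forall h x, GM h -> f (x *m A h) = phi h (f x).

Definition Mlam (n : nat) (A : gT -> 'M[C]_n) (w : 'rV[C]_n) (m : M) :=
  exists f, tga_hom A f /\ m = f w.

End TwGrpAlg.
End VOADefs.

(* Main.v *)
Require Import Defs.
From HB Require Import structures.
From mathcomp Require Import all_boot all_order all_algebra all_fingroup all_solvable.
From mathcomp Require Import reals trigo.
From mathcomp Require Import complex.
From mathcomp Require Import boolp zify ring lra.
Import Order.TTheory GRing.Theory Num.Theory.
Local Open Scope ring_scope.
Set Implicit Arguments.
Unset Strict Implicit.
Unset Printing Implicit Defensive.

(* By the twisted Jacobi identity the vectors u_k x, for a fixed x in a weak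
   twisted module, span a submodule. Applied to finite direct sums of the twists
   M o h, with Schur's lemma and Goursat's lemma, this gives a density theorem for
   single modes: a linear combination of modes can act on finitely many
   independent vectors of pairwise inequivalent M o h in any prescribed way.
   Averaging over G turns it into density of the modes of V^G in the commutant of
   G_M, hence the irreducibility of the M_lambda. Simplicity of V makes the phi(h)
   linearly independent, so every W_lambda occurs in M; the decomposition of M is
   then Schur orthogonality and Maschke's theorem for C^alpha[G_M]. *)

(** Single modes matter because averaging over [G] is linear in the vector: the average of [u_k] is
    a mode of a vector of [V^G], whereas the average of a product [u_a v_b] is not visibly built
    from such modes. Hence spans of single modes replace the algebra generated by all modes. As [M]
    is in general infinite-dimensional, Schur's lemma takes its eigenvalue from a finite-dimensional
    eigenspace of [L(0)], and Maschke's theorem is applied to the regular module of [C^alpha[G_M]],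
    whose homomorphic images cover [M]. *)

(** * Linear maps and subspaces given by predicates *)

Section LinearMaps.
Variable R : realType.
Local Notation C := (complex R).
Implicit Types V W : lmodType C.

Lemma linmap0 V W (f : V -> W) : linmap f -> f 0 = 0.
Proof.
move=> lf; have := lf (-1) 0 0.
by rewrite scaler0 addr0 scaleN1r addNr.
Qed.

Lemma linmapD V W (f : V -> W) x y : linmap f -> f (x + y) = f x + f y.
Proof. by move=> lf; have := lf 1 x y; rewrite !scale1r. Qed.

Lemma linmapZ V W (f : V -> W) a x : linmap f -> f (a *: x) = a *: f x.
Proof. by move=> lf; have := lf a x 0; rewrite (linmap0 lf) !addr0. Qed.

Lemma linmapN V W (f : V -> W) x : linmap f -> f (- x) = - f x.
Proof. by move=> lf; rewrite -scaleN1r linmapZ // scaleN1r. Qed.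

Lemma linmapB V W (f : V -> W) x y : linmap f -> f (x - y) = f x - f y.
Proof. by move=> lf; rewrite linmapD // linmapN. Qed.

Lemma linmap_sum V W (f : V -> W) (I : Type) (r : seq I) (P : pred I)
    (F : I -> V) :
  linmap f -> f (\sum_(i <- r | P i) F i) = \sum_(i <- r | P i) f (F i).
Proof.
move=> lf; apply: (big_morph f _ (linmap0 lf)) => x y; exact: linmapD.
Qed.

Lemma linmap_comp V1 V2 V3 (f : V2 -> V3) (h : V1 -> V2) :
  linmap f -> linmap h -> linmap (fun x => f (h x)).
Proof. by move=> lf lh a x y; rewrite lh lf. Qed.

Lemma linmap_inv V W (f : V -> W) (f' : W -> V) :
  linmap f -> cancel f f' -> cancel f' f -> linmap f'.
Proof. by move=> lf fK f'K a x y; rewrite -{1}(f'K x) -{1}(f'K y) -lf fK. Qed.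

Lemma subspaceD W (P : W -> Prop) x y : subspace P -> P x -> P y -> P (x + y).
Proof. by move=> [_ sP] Px Py; have := sP 1 _ _ Px Py; rewrite scale1r. Qed.

Lemma subspaceZ W (P : W -> Prop) a x : subspace P -> P x -> P (a *: x).
Proof. by move=> [P0 sP] Px; have := sP a _ _ Px P0; rewrite addr0. Qed.

Lemma subspaceB W (P : W -> Prop) x y : subspace P -> P x -> P y -> P (x - y).
Proof.
by move=> sP Px Py; rewrite -scaleN1r; apply: subspaceD => //; apply: subspaceZ.
Qed.

Lemma subspace_sum W (P : W -> Prop) (I : Type) (r : seq I) (Q : pred I)
    (F : I -> W) :
  subspace P -> (forall i, Q i -> P (F i)) -> P (\sum_(i <- r | Q i) F i).
Proof.
move=> sP PF; apply: (big_ind P) => //; first by case: sP.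
move=> x y; exact: subspaceD.
Qed.

Lemma linmap_injective V W (f : V -> W) :
  linmap f -> (forall x, f x = 0 -> x = 0) -> injective f.
Proof.
move=> lf f0 x y fxy; apply/eqP; rewrite -subr_eq0; apply/eqP/f0.
by rewrite linmapB // fxy subrr.
Qed.

Lemma gbinom0 (x : C) : gbinom x 0 = 1.
Proof. by rewrite /gbinom big_ord0 fact0 divr1. Qed.

End LinearMaps.

Lemma uniform_int_bound (I : finType) (P : I -> int -> Prop) :
  (forall i, exists N : int, forall n, N <= n -> P i n) ->
  exists N : nat, forall i n, N%:Z <= n -> P i n.
Proof.
move=> /fin_all_exists[N NP]; exists (\sum_i `|N i|)%N => i n len.
by apply: NP; rewrite (bigD1 i) //= in len; lia.
Qed.

Lemma uniform_nat_bound (I : finType) (P : I -> nat -> Prop) :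
  (forall i, exists N : nat, forall n, (N <= n)%N -> P i n) ->
  exists N : nat, forall i n, (N <= n)%N -> P i n.
Proof.
move=> /fin_all_exists[N NP]; exists (\sum_i N i)%N => i n len.
by apply: NP; rewrite (bigD1 i) //= in len; lia.
Qed.

(** Truncation kills all modes of large index, so claims about modes are proved downwards from large
    indices. *)
Lemma int_down_ind (P : int -> Prop) (N : int) :
  (forall n, N <= n -> P n) ->
  (forall n, (forall m, n < m -> P m) -> P n) -> forall n, P n.
Proof.
move=> PN Pstep n.
have [d le_d] : exists d : nat, N - n <= d%:Z by exists `|N - n|%N; lia.
elim: d n le_d => [|d IHd] n le_d; first by apply: PN; lia.
by apply: Pstep => m lt_nm; apply: IHd; lia.
Qed.

(** * Eigenspaces of an operator of finite order *)

Section EigenDecomposition.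
Variables (R : realType) (gT : finGroupType) (g : gT).
Local Notation C := (complex R).
Local Notation T := (tord g).
Local Notation eta := (Defs.eta R g).

Lemma tord_gt0 : (0 < T)%N. Proof. exact: order_gt0. Qed.

Lemma eta_exp j :
  eta ^+ j = Complex (cos (j%:R * (2 * pi / T%:R))) (- sin (j%:R * (2 * pi / T%:R))).
Proof.
elim: j => [|j IHj]; first by rewrite expr0 mul0r cos0 sin0 oppr0.
rewrite exprS IHj /Defs.eta; set t : R := 2 * pi / _.
have -> : j.+1%:R * t = t + j%:R * t by rewrite -add1n natrD mulrDl mul1r.
rewrite cosD sinD.
by apply/eqP; rewrite eq_complex /=; apply/andP; split; apply/eqP; ring.
Qed.

Lemma eta_expT : eta ^+ T = 1.
Proof.
have T0 : (T%:R : R) != 0 by rewrite pnatr_eq0 -lt0n tord_gt0.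
have -> : eta ^+ T = Complex (cos (2 * pi)) (- sin (2 * pi)).
  by rewrite eta_exp mulrC divfK.
by rewrite mulr_natl cos2pi sin2pi oppr0.
Qed.

Lemma eta_expVT r : (eta ^- r) ^+ T = 1.
Proof. by rewrite exprVn -exprM mulnC exprM eta_expT expr1n invr1. Qed.

Lemma eta_exp_neq1 j : (0 < j < T)%N -> eta ^+ j != 1.
Proof.
move=> /andP[j0 ltjT]; rewrite eta_exp eq_complex /= negb_and; apply/orP; left.
have T0 : (0 : R) < T%:R by rewrite ltr0n tord_gt0.
have pi0 := pi_gt0 R.
(* With [t = j pi / T], strictly between 0 and pi, the real part is [1 - 2 sin^2 t], and [sin t] is
   positive. *)
have -> : j%:R * (2 * pi / T%:R) = (j%:R * (pi / T%:R)) *+ 2 :> R.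
  by rewrite mulr2n; ring.
rewrite cos_mulr2n cos2sin2.
have s0 : 0 < sin (j%:R * (pi / T%:R) : R).
  apply: sin_gt0_pi; apply/andP; split.
    by rewrite mulr_gt0 ?ltr0n // divr_gt0.
  rewrite mulrCA gtr_pMr // ltr_pdivrMr // mul1r ltr_nat //.
by apply/eqP => E; have := exprn_gt0 2 s0; nra.
Qed.

Lemma eta_neq0 : eta != 0.
Proof.
apply/eqP => e0; have := eta_expT; rewrite e0 expr0n.
by rewrite eqn0Ngt tord_gt0 => /eqP; rewrite eq_sym oner_eq0.
Qed.

(** Discrete Fourier transform: the [r]-th component is [1/T] times the sum of [eta^(-rj) f^j u]
    over [j]. Summing over [r] leaves only [j = 0], since the other geometric sums of roots of unity
    vanish. *)
Lemma eigen_decomposition (V : lmodType C) (f : V -> V) :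
  linmap f -> (forall v, iter T f v = v) ->
  forall u, exists ur : nat -> V,
    (forall r, f (ur r) = eta ^+ r *: ur r) /\ u = \sum_(r < T) ur r.
Proof.
move=> lf fT u.
have T0 : (T%:R : C) != 0 by rewrite pnatr_eq0 -lt0n tord_gt0.
pose F r j := (eta ^- r) ^+ j *: iter j f u.
exists (fun r => T%:R^-1 *: \sum_(j < T) F r j); split=> [r|].
  rewrite linmapZ // linmap_sum // scalerA mulrC -scalerA; congr (_ *: _).
  have shift : \sum_(j < T) F r j.+1 = \sum_(j < T) F r j.
    have := @big_ord_recl V 0 +%R T (F r).
    rewrite big_ord_recr /= /F fT expr0 eta_expVT addrC => /addrI->.
    by apply: eq_bigr.
  rewrite -[in RHS]shift scaler_sumr; apply: eq_bigr => j _.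
  by rewrite /F linmapZ // scalerA exprS mulrA mulfV ?mul1r ?expf_neq0 ?eta_neq0.
rewrite -scaler_sumr exchange_big /=.
case E: T T0 fT => [|n] T0 fT; first by rewrite -E in T0; have := tord_gt0; rewrite E.
rewrite [X in _ = _ *: X]big_ord_recl [X in _ = _ *: (_ + X)]big1 => [|[j /= ltj] _]; last first.
  rewrite /F /= /bump /= add1n -scaler_suml.
  set z := eta ^- j.+1.
  have z1 : 1 - z != 0.
    rewrite subr_eq0 eq_sym /z invr_eq1; apply: eta_exp_neq1; rewrite E; lia.
  have geo : (1 - z) * \sum_(i < n.+1) z ^+ i = 1 - z ^+ n.+1.
    by rewrite -[LHS]opprK -mulNr opprB -subrX1 opprB.
  have := geo; rewrite -E eta_expVT subrr => /eqP.
  rewrite mulf_eq0 (negPf z1) /= => /eqP S0.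
  rewrite (eq_bigr (fun i : 'I_T => (eta ^- j.+1) ^+ i)) ?S0 ?scale0r // => i _.
  by rewrite -!exprVn -!exprM mulnC.
rewrite addr0 /F /= (eq_bigr (fun=> u)) => [|i _]; last by rewrite expr0 scale1r.
by rewrite sumr_const card_ord -[u *+ _]scaler_nat scalerA mulVf ?scale1r.
Qed.

End EigenDecomposition.

(** * Twisted modules *)

Section TwistedModules.
Variables (R : realType) (V : lmodType (complex R)) (Y : V -> int -> V -> V).
Variables (one : V) (gT : finGroupType) (act : gT -> V -> V) (g : gT).
Local Notation C := (complex R).
Local Notation T := (tord g).
Hypotheses (bilY : bilin_op Y) (truncY : truncated Y).
Hypotheses (lin_g : linmap (act g)) (iter_g : forall v, iter T (act g) v = v).
Variables (M : lmodType C) (Ym : V -> int -> M -> M).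
Hypothesis twM : weak_twisted_module Y one act g Ym.

Lemma mode_linr u k : linmap (Ym u k).
Proof. by case: twM => [[_ lr] _ _ _ _] a x y; apply: lr. Qed.

Lemma mode_linl k w : linmap (fun u => Ym u k w).
Proof. by case: twM => [[ll _] _ _ _ _] a x y; apply: ll. Qed.

Lemma mode_one w : Ym one (- T%:Z) w = w.
Proof. by case: twM => [_ _ _ one_m _]; rewrite one_m eqxx. Qed.

Lemma mode_grade r u k w : (r < T)%N -> Vr act g r u ->
  (k %% T%:Z)%Z != r%:Z -> Ym u k w = 0.
Proof. by case: twM => [_ _ gr _ _]; apply: gr. Qed.

Lemma Vr_decomposition u : exists ur : nat -> V,
  (forall r, Vr act g r (ur r)) /\ u = \sum_(r < T) ur r.
Proof. exact: (eigen_decomposition lin_g iter_g). Qed.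

(** The Jacobi identity is available only when its first vector lies in some [V^r]; linearity
    reduces to that case. *)
Lemma Vr_ind (P : V -> Prop) :
  subspace P -> (forall r u, (r < T)%N -> Vr act g r u -> P u) -> forall u, P u.
Proof.
move=> sP Pr u; have [ur [urr ->]] := Vr_decomposition u.
by apply: subspace_sum => // r _; apply: Pr (ltn_ord r) (urr r).
Qed.

Lemma mode_truncated_uniform (I : finType) (u : V) (y : I -> M) :
  exists N : nat, forall i k, N%:Z <= k -> Ym u k (y i) = 0.
Proof.
apply: uniform_int_bound => i.
by case: twM => [_ tr _ _ _]; have [N HN] := tr u (y i); exists N.
Qed.

Lemma mode_truncated u x : exists N : nat, forall k, N%:Z <= k -> Ym u k x = 0.
Proof.
have [N HN] := mode_truncated_uniform u (fun _ : 'I_1 => x).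
by exists N => k; apply: (HN ord0).
Qed.

Definition mode_span (x y : M) :=
  exists s : seq (V * int), y = \sum_(p <- s) Ym p.1 p.2 x.

Lemma mode_span_subspace x : subspace (mode_span x).
Proof.
split=> [|a _ _ [s1 ->] [s2 ->]]; first by exists [::]; rewrite big_nil.
exists ([seq (a *: p.1, p.2) | p <- s1] ++ s2).
rewrite big_cat big_map scaler_sumr; congr (_ + _).
by apply: eq_bigr => p _; rewrite (linmapZ a p.1 (mode_linl p.2 x)).
Qed.

Lemma mode_span_mode x u k : mode_span x (Ym u k x).
Proof. by exists [:: (u, k)]; rewrite big_seq1. Qed.

Lemma mode_span_refl x : mode_span x x.
Proof. by rewrite -[X in mode_span _ X]mode_one; apply: mode_span_mode. Qed.

(* With m so large that the modes u_(m+iT) kill x, the twisted Jacobi identity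
   expresses u_a v_b x through single modes and the u_(a-iT) v_(b+iT) x, i > 0. *)
Lemma mode_span_mul x u a v b : mode_span x (Ym u a (Ym v b x)).
Proof.
have sx := mode_span_subspace x.
have T0 : (0 < T)%N := tord_gt0 g.
move: u a b; apply: Vr_ind => [|r u ltrT ur a].
  split=> [a b|c u1 u2 P1 P2 a b].
    by rewrite (linmap0 (mode_linl a _)); case: sx.
  by rewrite (mode_linl a _); case: sx => _; apply.
case: (eqVneq (a %% T%:Z)%Z r%:Z) => [ar|/(mode_grade _ ltrT ur) a0 b]; last first.
  by rewrite a0; case: sx.
move=> b; have [Nv HNv] := mode_truncated v x.
move: b a ar; apply: (int_down_ind (N := Nv%:Z)) => [b leb a ar|b IHb a ar].
  by rewrite HNv // (linmap0 (mode_linr u a)); case: sx.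
have [N HN] := mode_truncated u x.
(* The exponent [- c] in the Jacobi identity gives [m - c T = a], so the term [i = 0] of its right
   side starts with [u_a v_b x]. *)
pose c := `|N%:Z - a|%N; pose m := a + c%:Z * T%:Z.
have lem : N%:Z <= m by rewrite /m /c; nia.
have mr : (m %% T%:Z)%Z = r%:Z by rewrite /m addrC modzMDl.
case: twM => [_ _ _ _ /(_ r u v x m b (- c%:Z) ltrT ur mr)[K0 /(_ K0.+1 (leqnSn _))]].
rewrite [RHS]big_ord_recl => E.
have -> : Ym u a (Ym v b x) = \sum_(i < K0.+1) gbinom (m%:~R / T%:R) i *:
       Ym (Y u (- c%:Z + i%:Z) v) (m + b - i%:Z * T%:Z) x -
   \sum_(i < K0) ((-1) ^+ i.+1 * gbinom (- c%:Z)%:~R i.+1) *: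
            (Ym u (m + (- c%:Z - i.+1%:Z) * T%:Z) (Ym v (b + i.+1%:Z * T%:Z) x)).
  rewrite E /= expr0 gbinom0 mulr1 scale1r HN; last by lia.
  rewrite (linmap0 (mode_linr _ _)) scaler0 subr0 mul0r addr0 subr0.
  have -> : m + - c%:Z * T%:Z = a by rewrite /m; lia.
  rewrite -addrA -[LHS]addr0; congr (_ + _); apply/esym/eqP; rewrite subr_eq0.
  apply/eqP; apply: eq_bigr => i _.
  rewrite HN; last by nia.
  by rewrite (linmap0 (mode_linr _ _)) scaler0 subr0 /bump /= add1n.
apply: (subspaceB sx); apply: (subspace_sum _ sx) => i _.
  by apply: (subspaceZ _ sx); apply: mode_span_mode.
apply: (subspaceZ _ sx); apply: IHb; first by lia.
by rewrite -ar /m -addrA -mulrDl addrC modzMDl.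
Qed.

Lemma mode_span_submod x : submod_for Ym (fun _ => True) (mode_span x).
Proof.
split=> [|u k _ _ [s ->]]; first exact: mode_span_subspace.
rewrite (linmap_sum _ _ _ (mode_linr u k)).
apply: (subspace_sum _ (mode_span_subspace x)) => p _; exact: mode_span_mul.
Qed.

(* For p so large that the u_(p+i) v_l vanish, the Jacobi identity is a
   commutativity relation, read downwards from the largest non-trivial u_m y_l. *)
Lemma mode_kernel_stable (I : finType) (v : I -> V) (y : I -> M) :
  (forall k, \sum_i Ym (v i) k (y i) = 0) ->
  forall u a k, \sum_i Ym (v i) k (Ym u a (y i)) = 0.
Proof.
move=> ker0; apply: Vr_ind => [|r u ltrT ur a].
  split=> [a k|c u1 u2 P1 P2 a k].
    apply: big1 => i _.
    by rewrite (linmap0 (mode_linl a _)) (linmap0 (mode_linr _ k)).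
  transitivity (c *: (\sum_i Ym (v i) k (Ym u1 a (y i)))
                + \sum_i Ym (v i) k (Ym u2 a (y i))).
    2: by rewrite P1 P2 scaler0 addr0.
  rewrite scaler_sumr -big_split; apply: eq_bigr => i _ /=.
  by rewrite (mode_linl a _) (mode_linr _ k).
case: (eqVneq (a %% T%:Z)%Z r%:Z) => [ar|/(mode_grade _ ltrT ur) a0 k]; last first.
  by apply: big1 => i _; rewrite a0 (linmap0 (mode_linr _ k)).
have [N HN] := mode_truncated_uniform u y.
have [P HP] : exists P : nat, forall i k, P%:Z <= k -> Y u k (v i) = 0.
  apply: uniform_int_bound => i; have [P HP] := truncY u (v i).
  by exists P.
move: a ar; apply: (int_down_ind (N := N%:Z)) => [a lea ar k|m IHm mr k].
  by apply: big1 => i _; rewrite HN // (linmap0 (mode_linr _ k)).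
case: twM => [_ _ _ _ jac].
have [K0 HK] := uniform_nat_bound (fun i : I =>
  jac r u (v i) (y i) m (k - P%:Z * T%:Z) P%:Z ltrT ur mr).
have {}HK i := HK i K0.+1 (leqnSn _).
have: \sum_i \sum_(j < K0.+1) ((-1) ^+ j * gbinom P%:~R j) *:
   (Ym u (m + (P%:Z - j%:Z) * T%:Z) (Ym (v i) (k - P%:Z * T%:Z + j%:Z * T%:Z) (y i)) -
    (-1) ^ P%:Z *: Ym (v i) (k - P%:Z * T%:Z + (P%:Z - j%:Z) * T%:Z)
                       (Ym u (m + j%:Z * T%:Z) (y i))) = 0.
  apply: big1 => i _; rewrite -HK; apply: big1 => j _.
  by rewrite HP ?(linmap0 (mode_linl _ _)) ?scaler0 //; lia.
(* Summed over [i], the terms with [u] outermost become a mode of [u] applied to a sum that vanishes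
   by [ker0]; only those with [v i] outermost survive. *)
have factor c d a e (Z : I -> M) :
    \sum_i c *: (Ym u a (Ym (v i) e (y i)) - d *: Z i) = (- (c * d)) *: \sum_i Z i.
  transitivity (c *: Ym u a (\sum_i Ym (v i) e (y i)) + (- (c * d)) *: \sum_i Z i).
    2: by rewrite ker0 (linmap0 (mode_linr u a)) scaler0 add0r.
  rewrite (linmap_sum _ _ _ (mode_linr u a)) !scaler_sumr -big_split /=.
  by apply: eq_bigr => i _; rewrite scalerBr scalerA scaleNr.
rewrite exchange_big /= big_ord_recl [X in _ + X]big1 => [|j _]; last first.
  rewrite factor IHm ?scaler0 //; first by rewrite /= /bump; have := tord_gt0 g; nia.
  by rewrite addrC modzMDl.
rewrite factor /= expr0 gbinom0 mulr1 mul1r mul0r !addr0 ?subr0 subrK => /eqP.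
by rewrite scaler_eq0 oppr_eq0 signr_eq0 /= => /eqP.
Qed.

(** * Faithfulness of twisted modules over a simple algebra *)

Definition annihilates (v : V) := forall k w, Ym v k w = 0.

(** Downward induction on [p]. The right side of the Jacobi identity vanishes; its left side has
    leading term [(u_p v)_k w] with coefficient 1, and the later terms involve [u_(p+i) v] with
    [i > 0]. *)
Lemma annihilates_product r u v p :
  (r < T)%N -> Vr act g r u -> annihilates u \/ annihilates v ->
  annihilates (Y u p v).
Proof.
move=> ltrT ur uv.
have [P HP] := truncY u v.
move: p; apply: (int_down_ind (N := P)) => [p lep k w|p IHp k w].
  by rewrite HP // (linmap0 (mode_linl k w)).
have mr : (r%:Z %% T%:Z)%Z = r%:Z by rewrite modz_small //; lia.
case: twM => [_ _ _ _ /(_ r u v w r%:Z (k - r%:Z) p ltrT ur mr)[K0]].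
move=> /(_ K0.+1 (leqnSn _)); rewrite [RHS]big1 => [|i _]; last first.
  by case: uv => uv0; rewrite !uv0 !(linmap0 (mode_linr _ _)) scaler0 subr0 scaler0.
rewrite big_ord_recl [X in _ + X]big1 => [|i _]; last by rewrite IHp ?scaler0 //= /bump; lia.
by rewrite /= gbinom0 scale1r mul0r !addr0 addrCA subrr addr0.
Qed.

Lemma annihilates_subspace : subspace annihilates.
Proof.
split=> [k w|a u v Hu Hv k w]; first exact: (linmap0 (mode_linl k w)).
by rewrite (mode_linl k w) Hu Hv scaler0 addr0.
Qed.

(** Modes of vectors of [V^r] live on indices congruent to [r] modulo [T], so each index sees a
    single component of [u]. *)
Lemma annihilates_component u (ur : nat -> V) :
  (forall r, Vr act g r (ur r)) -> u = \sum_(r < T) ur r -> annihilates u ->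
  forall r : 'I_T, annihilates (ur r).
Proof.
move=> urr uE u0 r k w.
case: (eqVneq (k %% T%:Z)%Z r%:Z) => [kr|/mode_grade->//].
rewrite -(u0 k w) uE (linmap_sum _ _ _ (mode_linl k w)) (bigD1 r) //= big1 ?addr0 //.
move=> j neq_jr; rewrite (mode_grade _ (ltn_ord j) (urr j)) // kr.
by apply: contra neq_jr => /eqP[E]; apply/eqP/val_inj.
Qed.

(** For the products [w_n u] the annihilating vector comes first in the Jacobi identity, so it is
    itself split into eigenvectors, which still annihilate. *)
Lemma annihilates_ideal : ideal Y annihilates.
Proof.
split=> [|u n w w0]; first exact: annihilates_subspace.
have [bl br] := bilY.
split.
  move: u; apply: Vr_ind => [|r u ltrT ur].
    have lin : linmap (fun u => Y u n w) by move=> a x y; apply: bl.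
    split=> [|a x y]; first by rewrite (linmap0 lin); case: annihilates_subspace.
    by rewrite bl => *; case: annihilates_subspace => _; apply.
  by apply: (annihilates_product _ ltrT ur); right.
have [wr [wrr wE]] := Vr_decomposition w.
have lin : linmap (fun w => Y w n u) by move=> a x y; apply: bl.
rewrite {1}wE (linmap_sum _ _ _ lin).
apply: (subspace_sum _ annihilates_subspace) => r _.
apply: (annihilates_product _ (ltn_ord r) (wrr r)); left.
exact: annihilates_component wrr wE w0 r.
Qed.

Lemma annihilates_eq0 (om : V) w0 v :
  simple_VOA Y one om -> w0 != 0 :> M -> annihilates v -> v = 0.
Proof.
move=> [_ /(_ _ annihilates_ideal)[H|H]] w0_neq0; first exact: H.
by have := H one (- T%:Z) w0; rewrite mode_one => /eqP; rewrite (negPf w0_neq0).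
Qed.

End TwistedModules.

(** * Eigenvectors inside finite-dimensional invariant pieces *)

Section Schur.
Variable R : realType.
Local Notation C := (complex R).

Lemma findim_dependent (W : lmodType C) (P : W -> Prop) :
  findim P -> exists N, forall x : nat -> W, (forall i, P (x i)) ->
    exists2 c : 'rV[C]_N, c != 0 & \sum_(i < N) c 0 i *: x i = 0.
Proof.
move=> [s sP]; exists (size s).+1 => x Px.
have /fin_all_exists[c cE] (i : 'I_(size s).+1) := sP _ (Px i).
pose A := \matrix_(i < (size s).+1, j < size s) c i j.
have : kermx A != 0.
  rewrite kermx_eq0 /row_free; apply/eqP => rA.
  by have := rank_leq_col A; rewrite rA ltnn.
case/rowV0Pn => v /sub_kermxP vA v0; exists v => //.
under eq_bigr => i _ do rewrite cE scaler_sumr.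
rewrite exchange_big big1 // => j _ /=.
have := congr1 (fun B : 'rV_(size s) => B 0 j) vA; rewrite !mxE => vAj.
rewrite -[RHS](scale0r (s`_j)) -vAj scaler_suml.
by apply: eq_bigr => i _; rewrite scalerA mxE.
Qed.

Lemma linmap_iter (W : lmodType C) (F : W -> W) i : linmap F -> linmap (iter i F).
Proof. by move=> lF; elim: i => [//|i IHi] a x y; rewrite /= IHi lF. Qed.

(** Write [p = q (X - a)]: either [w] is an eigenvector for [a], or [F w - a w] is nonzero and
    killed by [q], of smaller size. *)
Lemma eigenvector_of_annihilator (W : lmodType C) (F : W -> W) n (p : {poly C}) w :
  linmap F -> p != 0 -> (size p <= n)%N -> w != 0 ->
  \sum_(i < n) p`_i *: iter i F w = 0 ->
  exists2 v, v != 0 & exists c, F v = c *: v.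
Proof.
move=> lF; elim: n p w => [|n IHn] p w p0 lep w0 pFw.
  by move: p0; rewrite -size_poly_gt0; lia.
have [sp1|sp1] := eqVneq (size p) 1%N.
  have /size_poly1P[c c0 pE] : size p == 1%N by rewrite sp1.
  move: pFw; rewrite big_ord_recl big1 => [|i _]; last by rewrite pE coefC scale0r.
  by rewrite /= addr0 pE coefC => /eqP; rewrite scaler_eq0 (negPf c0) (negPf w0).
have [a] := closed_rootP p sp1.
case/factor_theorem => q qE.
have q0 : q != 0 by apply: contraNneq p0 => q0; rewrite qE q0 mul0r.
have leq_n : (size q <= n)%N.
  by move: lep; rewrite qE size_Mmonic ?monicXsubC // size_XsubC addn2.
have [w'0|w'0] := eqVneq (F w - a *: w) 0.
  by exists w => //; exists a; apply/eqP; rewrite -subr_eq0 w'0.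
apply: (IHn q _ q0 leq_n w'0); rewrite -[RHS]pFw.
have lFi i := linmap_iter i lF.
have EL (i : 'I_n) : q`_i *: iter i F (F w - a *: w) =
    q`_i *: iter i.+1 F w - (q`_i * a) *: iter i F w.
  by rewrite (linmapB _ _ (lFi i)) (linmapZ _ _ (lFi i)) -iterSr scalerBr scalerA.
have ER (i : 'I_n.+1) : p`_i *: iter i F w =
    (if i == 0%N :> nat then 0 else q`_i.-1) *: iter i F w - (q`_i * a) *: iter i F w.
  by rewrite qE mulrBr coefB coefMX coefMC scalerBl.
rewrite (eq_bigr _ (fun i _ => EL i)) [RHS](eq_bigr _ (fun i _ => ER i)).
rewrite !big_split; congr (_ + _).
  by rewrite [RHS]big_ord_recl /= scale0r add0r.
rewrite [RHS]big_ord_recr /= (_ : q`_n = 0) ?mul0r ?scale0r ?oppr0 ?addr0 //.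
exact: nth_default.
Qed.

(** A linear dependence among the iterates of [F] on [w] is read as the polynomial required
    above. *)
Lemma eigenvector_exists (W : lmodType C) (P : W -> Prop) (F : W -> W) w :
  findim P -> linmap F -> (forall v, P v -> P (F v)) -> P w -> w != 0 ->
  exists2 v, v != 0 & exists c, F v = c *: v.
Proof.
move=> /findim_dependent[N dep] lF PF Pw w0.
have [|c c0 cE] := dep (fun i => iter i F w); first by elim=> //= i; apply: PF.
apply: (@eigenvector_of_annihilator _ F N (rVpoly c) w) => //.
- by by apply: contraNneq c0 => rc0; rewrite -[c]rVpolyK rc0 linear0.
- exact: size_poly.
- by rewrite -[RHS]cE; apply: eq_bigr => i _; rewrite coef_rVpoly_ord.
Qed.

End Schur.

(** * Goursat's lemma for submodules of finite powers *)

Section Goursat.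
Variables (R : realType).
Local Notation C := (complex R).
Variables (M : lmodType C) (I : finType) (J : Type) (op : I -> J -> M -> M).
Variable e : I -> I -> Prop.
Hypothesis e_refl : forall i, e i i.
Hypothesis op_lin : forall i j, linmap (op i j).
Hypothesis op_irr : forall i (Q : M -> Prop), subspace Q ->
  (forall j w, Q w -> Q (op i j w)) -> (forall w, Q w -> w = 0) \/ forall w, Q w.
Hypothesis op_hom : forall i i' (F : M -> M), linmap F ->
  (forall j w, F (op i j w) = op i' j (F w)) ->
  exists c, (forall w, F w = c *: w) /\ (e i i' \/ c = 0).
Variable P : {ffun I -> M} -> Prop.
Hypotheses (sP : subspace P).
Hypothesis opP : forall j y, P y -> P [ffun i => op i j (y i)].

(** Induction on [A], removing [j]. The [j]-th coordinates of the elements of [P] that vanish on the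
    rest of [A] form a submodule [K]. If [K] is everything, the [j]-th coordinate can be corrected
    freely. If [K] is zero, it is a function of the other coordinates, a sum of homomorphisms; these
    are scalars by [op_hom], zero across inequivalent indices, and give a relation. *)
Lemma goursat (A : {set I}) :
  (exists (i0 : I) (c : I -> C), [/\ c i0 != 0,
      (forall i, c i != 0 -> i \in A /\ e i i0) &
      forall y, P y -> \sum_i c i *: y i = 0]) \/
  (forall z : I -> M, exists y, P y /\ forall i, i \in A -> y i = z i).
Proof.
have [n leAn] := ubnP #|A|; elim: n A leAn => // n IHn A leAn.
have [->|[j jA]] := set_0Vmem A.
  by right=> z; exists 0; split=> [|i]; [case: sP | rewrite inE].
have leA'n : (#|A :\ j| < n)%N by have := cardsD1 j A; rewrite jA; lia.
have [[i0 [c [ci0 cA cP]]]|surj] := IHn _ leA'n.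
  left; exists i0, c; split=> // i /cA[]; by rewrite inE => /andP[].
pose K m := exists y, [/\ P y, forall i, i \in A :\ j -> y i = 0 & y j = m].
have sK : subspace K.
  split=> [|a _ _ [y1 [Py1 y10 <-]] [y2 [Py2 y20 <-]]].
    by exists 0; split=> [|i _|]; [case: sP | rewrite ffunE | rewrite ffunE].
  exists (a *: y1 + y2); split=> [|i iA|]; first by case: sP => _; apply.
    by rewrite !ffunE y10 // y20 // scaler0 addr0.
  by rewrite !ffunE.
have [k m [y [Py y0 <-]]|K0|KT] := @op_irr j K sK.
- exists [ffun i => op i k (y i)]; split=> [|i iA|]; first exact: opP.
    by rewrite ffunE y0 // linmap0.
  by rewrite ffunE.
- left.
  have uniq y1 y2 : P y1 -> P y2 -> (forall i, i \in A :\ j -> y1 i = y2 i) ->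
      y1 j = y2 j.
    move=> Py1 Py2 eqy; apply/eqP; rewrite -subr_eq0; apply/eqP/K0.
    exists (y1 - y2); split=> [|i iA|]; first exact: subspaceB.
      by rewrite !ffunE eqy // subrr.
    by rewrite !ffunE.
  (* [Yf (i, m)] has value [m] at [i] and 0 at the other indices of [A :\ j]; its [j]-th coordinate
     is the homomorphism in question. *)
  have /choice[Yf YfP] (p : I * M) := surj (fun k => if k == p.1 then p.2 else 0).
  have linYf i : i \in A :\ j -> linmap (fun m => Yf (i, m) j).
    move=> iA a x y.
    have [P1 E1] := YfP (i, a *: x + y).
    have [[P2 E2] [P3 E3]] := (YfP (i, x), YfP (i, y)).
    rewrite (uniq _ (a *: Yf (i, x) + Yf (i, y))) ?ffunE //.
      by case: sP => _; apply.
    move=> k kA; rewrite !ffunE E1 ?E2 ?E3 //=.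
    by case: eqP => // _; rewrite scaler0 addr0.
  have /fin_all_exists[c cP] i : exists c, i \in A :\ j ->
      (forall m, Yf (i, m) j = c *: m) /\ (e i j \/ c = 0).
    have [iA|_] := boolP (i \in A :\ j); last by exists 0.
    have [k m|c cE] := @op_hom i j _ (linYf i iA); last by exists c.
    have [[P1 E1] [P2 E2]] := (YfP (i, op i k m), YfP (i, m)).
    rewrite (uniq _ [ffun l => op l k (Yf (i, m) l)]) ?ffunE //.
      exact: opP.
    move=> l lA; rewrite ffunE E1 ?E2 //=.
    by case: (l =P i) => [->//|_]; rewrite linmap0.
  pose d i := if i == j then 1 else if i \in A then - c i else 0.
  exists j, d; split=> [|i|y Py]; first by rewrite /d eqxx oner_eq0.
    rewrite /d; case: (i =P j) => [-> _|/eqP neq_ij]; first by split.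
    case: ifP => [iA|_ /eqP//] ci0; split=> //.
    have [|_ [//|c0]] := cP i; first by rewrite !inE neq_ij.
    by rewrite c0 oppr0 eqxx in ci0.
  have yj : y j = \sum_(i in A :\ j) Yf (i, y i) j.
    rewrite (uniq y (\sum_(i in A :\ j) Yf (i, y i))) ?sum_ffunE ?ffunE //.
      by apply: subspace_sum => // i _; case: (YfP (i, y i)).
    move=> k kA; rewrite sum_ffunE (bigD1 k) //= big1 => [|i /andP[iA neq_ik]].
      by case: (YfP (k, y k)) => _ ->; rewrite //= eqxx addr0.
    by case: (YfP (i, y i)) => _ ->; rewrite //= eq_sym (negPf neq_ik).
  rewrite (bigD1 j) //= /d eqxx scale1r yj.
  rewrite [X in _ + X](bigID (mem (A :\ j))) /=.
  rewrite [X in _ + (_ + X)]big1 => [|i /andP[neq_ij]]; last first.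
    by rewrite !inE neq_ij /= => /negPf->; rewrite (negPf neq_ij) scale0r.
  rewrite addr0 [X in _ + X](eq_bigl (mem (A :\ j))) => [|i]; last first.
    by rewrite !inE; case: eqP.
  rewrite -big_split big1 //= => i iA; case: (cP i iA) => -> _.
  move: iA; rewrite !inE => /andP[/negPf-> ->]; by rewrite scaleNr subrr.
right=> z; have [y [Py yz]] := surj z.
have [y' [Py' y'0 y'j]] := KT (z j - y j).
exists (y + y'); split=> [|i iA]; first exact: subspaceD.
rewrite ffunE; have [->|neq_ij] := eqVneq i j; first by rewrite y'j addrC subrK.
by rewrite y'0 ?yz ?addr0 // !inE neq_ij.
Qed.

End Goursat.

Section RowSubspaces.
Variable R : realType.
Local Notation C := (complex R).

(** Gives a subspace the matrix form in which [tga_simple] tests invariance. A matrix of maximal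
    rank with row space inside [P] works, since adjoining a vector of [P] cannot raise its rank. *)
Lemma subspace_rowspace n (P : 'rV[C]_n -> Prop) : subspace P ->
  exists U : 'M[C]_n, forall x, (x <= U)%MS <-> P x.
Proof.
move=> sP.
pose p r := `[< exists U : 'M[C]_n, \rank U = r /\ forall x, (x <= U)%MS -> P x >].
have p0 : exists r, p r.
  exists 0%N; apply/asboolP; exists 0; split=> [|x]; first exact: mxrank0.
  by rewrite submx0 => /eqP->; case: sP.
have [|_ /asboolP[U [<- UP]] max] := ex_maxnP p0 (m := n).
  by move=> r /asboolP[U [<- _]]; apply: rank_leq_row.
exists U => x; split=> [|Px]; first exact: UP.
have subU : (U <= U + x)%MS := addsmxSl U x.
apply: submx_trans (addsmxSr U x) _; rewrite -(mxrank_leqif_sup subU).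
rewrite eqn_leq mxrankS //=; apply/max/asboolP; exists (U + x)%MS; split=> // y.
case/sub_addsmxP => -[a b] /= ->; apply: (subspaceD sP).
  by apply: UP; apply: submxMl.
by rewrite [b]mx11_scalar mul_scalar_mx; apply: subspaceZ.
Qed.

End RowSubspaces.

(** * Twisted group algebras *)

Section TwistedGroupAlgebra.
Variables (R : realType) (gT : finGroupType) (H : {group gT}) (GM : gT -> Prop).
Local Notation C := (complex R).
Variable alpha : gT -> gT -> C.
Hypothesis GMP : forall h, reflect (GM h) (h \in H).
Hypothesis alpha_neq0 : forall h k, h \in H -> k \in H -> alpha h k != 0.

Let GMin h : h \in H -> GM h. Proof. by move/GMP. Qed.
Let inGM h : GM h -> h \in H. Proof. by move/GMP. Qed.

Lemma tga_mod_unit n (A : gT -> 'M[C]_n) h : tga_mod GM alpha A -> h \in H ->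
  A h \in unitmx.
Proof.
move=> [A1 AM] hH; have hVH : h^-1%g \in H by rewrite groupV.
have := AM _ _ (GMin hH) (GMin hVH); rewrite mulgV A1 => E.
have : (alpha h h^-1%g)^-1 *: A h^-1%g *m A h = 1%:M.
  by rewrite -scalemxAl E scalerA mulVf ?scale1r ?alpha_neq0.
by case/mulmx1_unit.
Qed.

Lemma tga_mod_inv n (A : gT -> 'M[C]_n) h : tga_mod GM alpha A -> h \in H ->
  invmx (A h) = (alpha h h^-1%g)^-1 *: A h^-1%g.
Proof.
move=> modA hH; have uA := tga_mod_unit modA hH; have [A1 AM] := modA.
apply: (can_inj (mulmxK uA)); rewrite mulVmx // -scalemxAl.
rewrite AM ?mulgV ?A1; try by apply: GMin; rewrite ?groupV.
by rewrite scalerA mulVf ?scale1r ?alpha_neq0 ?groupV.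
Qed.

Lemma tga_mod_invM n (A : gT -> 'M[C]_n) h k : tga_mod GM alpha A ->
  h \in H -> k \in H -> A k *m invmx (A (k * h)%g) = alpha k h *: invmx (A h).
Proof.
move=> modA hH kH; have [_ AM] := modA; have khH := groupM kH hH.
apply: (can_inj (mulmxK (tga_mod_unit modA khH))).
rewrite mulmxKV ?(tga_mod_unit modA) // -scalemxAl scalemxAr -AM //; try exact: GMin.
by rewrite mulKmx // (tga_mod_unit modA).
Qed.

Definition average n m (A : gT -> 'M[C]_n) (B : gT -> 'M[C]_m) (X : 'M[C]_(n, m)) :=
  \sum_(h in H) invmx (A h) *m X *m B h.

Lemma average_intertwines n m (A : gT -> 'M[C]_n) (B : gT -> 'M[C]_m) X k :
  tga_mod GM alpha A -> tga_mod GM alpha B -> GM k ->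
  A k *m average A B X = average A B X *m B k.
Proof.
move=> modA modB kG; have kH := inGM kG; have [_ BM] := modB.
rewrite mulmx_sumr mulmx_suml (reindex_inj (mulgI k)) /=.
apply: eq_big => [h|h]; first by rewrite groupMl.
rewrite groupMl // => hH; rewrite -!mulmxA BM //; last exact: GMin.
by rewrite [LHS]mulmxA (tga_mod_invM modA) // -scalemxAl -!scalemxAr.
Qed.

Lemma tga_schur_iso n m (A : gT -> 'M[C]_n) (B : gT -> 'M[C]_m) X :
  tga_simple GM alpha A -> tga_simple GM alpha B ->
  (forall h, GM h -> A h *m X = X *m B h) -> X != 0 -> tga_iso GM A B.
Proof.
move=> [_ _ simA] [_ _ simB] XP X0.
have freeX : row_free X.
  rewrite -kermx_eq0 -mxrank_eq0.
  have /orP[//|full] : (\rank (kermx X) == 0)%N || row_full (kermx X).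
    apply: simA => h hG; apply/sub_kermxP.
    by rewrite -mulmxA XP // mulmxA mulmx_ker mul0mx.
  by case/negP: X0; rewrite -[X]mul1mx; apply/eqP/sub_kermxP/submx_full.
have fullX : row_full X.
  have /orP[|] : (\rank <<X>>%MS == 0)%N || row_full <<X>>%MS.
  - apply: simB => h hG; rewrite (eqmxMr _ (genmxE X)) genmxE -XP //.
    exact: submxMl.
  - by rewrite mxrank_gen mxrank_eq0 (negPf X0).
  - by rewrite /row_full mxrank_gen.
by exists X, (pinvmx X); split=> //; [apply: mulmxVp | apply: mulVpmx].
Qed.

Lemma tga_schur_scalar n (A : gT -> 'M[C]_n) X : tga_simple GM alpha A ->
  (forall h, GM h -> A h *m X = X *m A h) -> exists c, X = c%:M.
Proof.
move=> [_ n0 simA] XP; have [c] := @eigenvalue_closed _ n X n0.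
rewrite /eigenvalue -mxrank_eq0 => eig; exists c.
have /orP[E|/submx_full full] : (\rank (eigenspace X c) == 0)%N || row_full (eigenspace X c).
- apply: simA => h hG; apply/eigenspaceP; rewrite -mulmxA XP // mulmxA.
  by rewrite (eigenspaceP (submx_refl _)) -scalemxAl.
- by rewrite E in eig.
have /eigenspaceP := full _ (1%:M : 'M[C]_n).
by rewrite mul1mx scalemx1.
Qed.

(** Turns Schur's lemma for averages into the orthogonality relations between matrix entries. *)
Lemma average_delta n m (A : gT -> 'M[C]_n) (B : gT -> 'M[C]_m) q s p t :
  average A B (delta_mx q s) p t = \sum_(h in H) invmx (A h) p q * B h s t.
Proof.
rewrite summxE; apply: eq_bigr => h _.
rewrite mxE (bigD1 s) //= big1 => [|j neq_js].
  rewrite addr0 mxE (bigD1 q) //= big1 => [|i neq_iq].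
    by rewrite addr0 mxE !eqxx mulr1.
  by rewrite mxE (negPf neq_iq) mulr0.
rewrite mxE big1 ?mul0r // => i _.
by rewrite mxE (negPf neq_js) andbF mulr0.
Qed.

Lemma orthogonality_neq n m (A : gT -> 'M[C]_n) (B : gT -> 'M[C]_m) p q s t :
  tga_simple GM alpha A -> tga_simple GM alpha B -> ~ tga_iso GM A B ->
  \sum_(h in H) invmx (A h) p q * B h s t = 0.
Proof.
move=> simA simB niso; rewrite -average_delta.
have [->|X0] := eqVneq (average A B (delta_mx q s)) 0; first by rewrite mxE.
case: niso; apply: (tga_schur_iso simA simB _ X0) => h.
by have [[modA _ _] [modB _ _]] := (simA, simB); apply: average_intertwines.
Qed.

Lemma orthogonality_eq n (A : gT -> 'M[C]_n) : tga_simple GM alpha A ->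
  exists2 c : C, c != 0 & forall p q s t,
    \sum_(h in H) invmx (A h) p q * A h s t = c * ((p == t) && (q == s))%:R.
Proof.
move=> simA; have [modA n0 _] := simA.
have n0C : n%:R != 0 :> C by rewrite pnatr_eq0 -lt0n.
have H0C : #|H|%:R != 0 :> C by rewrite pnatr_eq0 -lt0n cardG_gt0.
exists (#|H|%:R / n%:R) => [|p q s t]; first by rewrite mulf_neq0 ?invr_eq0.
rewrite -average_delta.
have [|c cE] := @tga_schur_scalar n A (average A A (delta_mx q s)) simA.
  by move=> h; apply: average_intertwines.
(* The scalar is found by taking traces: each conjugate of [delta_mx q s] has the trace of
   [delta_mx q s]. *)
have : c * n%:R = #|H|%:R * (q == s)%:R.
  rewrite mulr_natr -mxtrace_scalar -cE linear_sum /=.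
  rewrite (eq_bigr (fun=> (q == s)%:R)) => [|h hH].
    by rewrite sumr_const -[_ *+ _]mulr_natl.
  rewrite mxtrace_mulC mulmxA mulmxV ?(tga_mod_unit modA) // mul1mx.
  rewrite /mxtrace (bigD1 q) //= big1 => [|i neq_iq].
    by rewrite addr0 mxE eqxx.
  by rewrite mxE (negPf neq_iq).
rewrite cE mxE => /(canRL (mulfK n0C)) ->.
by case: (p == t); case: (q == s); rewrite ?mulr1n ?mulr0n ?mulr0 ?mul0r ?mulr1.
Qed.

Lemma tga_maschke N (A : gT -> 'M[C]_N) (U : 'M[C]_N) : tga_mod GM alpha A ->
  (forall h, GM h -> (U *m A h <= U)%MS) ->
  exists pr : 'M[C]_N, [/\ forall h, GM h -> A h *m pr = pr *m A h,
    (pr <= U)%MS & U *m pr = U].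
Proof.
move=> modA invU; have H0C : #|H|%:R != 0 :> C by rewrite pnatr_eq0 -lt0n cardG_gt0.
(* [Q *m U] is a linear projection onto [U], to be averaged over the group. *)
have [Q QK] : exists Q, forall W : 'M[C]_N, (W <= U)%MS -> W *m Q *m U = W.
  by exists (pinvmx U) => W; apply: mulmxKpV.
exists (#|H|%:R^-1 *: average A A (Q *m U)); split=> [h hG||].
- by rewrite -scalemxAr average_intertwines // scalemxAl.
- apply: scalemx_sub; apply: summx_sub => h hH; rewrite mulmxA -mulmxA.
  by apply: mulmx_sub; apply: invU; apply: GMin.
rewrite -scalemxAr mulmx_sumr (eq_bigr (fun=> U)) => [|h hH].
  by rewrite sumr_const -[U *+ _]scaler_nat scalerA mulVf ?scale1r.
have subU : (U *m invmx (A h) <= U)%MS.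
  rewrite (tga_mod_inv modA hH) -scalemxAr; apply: scalemx_sub; apply: invU.
  by apply: GMin; rewrite groupV.
by rewrite !mulmxA QK // mulmxKV // (tga_mod_unit modA).
Qed.

Lemma minimal_submodule N (A : gT -> 'M[C]_N) (U : 'M[C]_N) : U != 0 ->
  (forall h, GM h -> (U *m A h <= U)%MS) ->
  exists S : 'M[C]_N, [/\ S != 0, (S <= U)%MS,
    forall h, GM h -> (S *m A h <= S)%MS &
    forall S' : 'M[C]_N, S' != 0 -> (S' <= U)%MS ->
      (forall h, GM h -> (S' *m A h <= S')%MS) -> (\rank S <= \rank S')%N].
Proof.
move=> U0 invU; pose p r := `[< exists S : 'M[C]_N, [/\ \rank S = r, S != 0,
  (S <= U)%MS & forall h, GM h -> (S *m A h <= S)%MS] >].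
have p0 : exists r, p r by exists (\rank U); apply/asboolP; exists U.
have [_ /asboolP[S [<- S0 SU invS]] min] := ex_minnP p0.
exists S; split=> // S' S'0 S'U invS'; apply: min.
by apply/asboolP; exists S'.
Qed.

Lemma minimal_submodule_simple N (A : gT -> 'M[C]_N) (S : 'M[C]_N) :
  tga_mod GM alpha A -> S != 0 -> (forall h, GM h -> (S *m A h <= S)%MS) ->
  (forall S' : 'M[C]_N, S' != 0 -> (S' <= S)%MS ->
      (forall h, GM h -> (S' *m A h <= S')%MS) -> (\rank S <= \rank S')%N) ->
  exists2 B : gT -> 'M[C]_(\rank S), tga_simple GM alpha B &
    forall h, GM h -> B h *m row_base S = row_base S *m A h.
Proof.
move=> [A1 AM] S0 invS min; set b := row_base S.
pose B h := b *m A h *m pinvmx b.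
have BE h : GM h -> B h *m b = b *m A h.
  move=> hG; apply: mulmxKpV.
  by rewrite (eqmxMr _ (eq_row_base S)) eq_row_base invS.
have free_b : row_free b := row_base_free S.
have G1 : GM 1%g := GMin (group1 H).
exists B => //; split; last 2 first.
- by rewrite lt0n mxrank_eq0.
- move=> U invU; have [->|U0] := eqVneq U 0; first by rewrite mxrank0.
  apply/orP; right; rewrite /row_full eqn_leq rank_leq_col /=.
  suff: (\rank S <= \rank <<U *m b>>)%N by rewrite mxrank_gen mxrankMfree.
  apply: min.
  + by rewrite -mxrank_eq0 mxrank_gen mxrankMfree ?mxrank_eq0.
  + by rewrite genmxE; apply: submx_trans (submxMl _ _) _; rewrite eq_row_base.
  + move=> h hG; rewrite (eqmxMr _ (genmxE _)) genmxE -mulmxA -BE // mulmxA.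
    by apply: submxMr; apply: invU.
split=> [|h k hG kG]; apply: (row_free_inj free_b).
  by rewrite BE // A1 mulmx1 mul1mx.
rewrite -mulmxA BE // mulmxA BE // -mulmxA AM // -scalemxAl BE ?scalemxAr //.
by apply: GMin; rewrite groupM ?inGM.
Qed.

(** Complete reducibility as an induction principle: the images of the listed simple modules span
    every module. A minimal submodule is split off by Maschke's projection, and the complement has
    smaller rank. *)
Lemma tga_semisimple (k : nat) (n : 'I_k -> nat) (A : forall j, gT -> 'M[C]_(n j))
    N (B : gT -> 'M[C]_N) (P : 'rV[C]_N -> Prop) :
  complete_simples GM alpha A -> tga_mod GM alpha B -> subspace P ->
  (forall j (X : 'M[C]_(n j, N)), (forall h, GM h -> A j h *m X = X *m B h) ->
     forall y, P (y *m X)) -> forall x, P x.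
Proof.
move=> [_ _ compl] modB sP PX x.
suff H1 r (U : 'M[C]_N) : (\rank U < r)%N -> (forall h, GM h -> (U *m B h <= U)%MS) ->
    forall x : 'rV_N, (x <= U)%MS -> P x.
  by apply: (H1 N.+1 1%:M); rewrite ?submx1 ?ltnS ?rank_leq_row // => h _; apply: submx1.
elim: r U => // r IHr U leUr invU {}x xU.
have [U0|U0] := eqVneq U 0.
  by move: xU; rewrite U0 submx0 => /eqP->; case: sP.
have [S [S0 SU invS min]] := minimal_submodule U0 invU.
have [|B' simB' BE] := minimal_submodule_simple modB S0 invS.
  by move=> S' S'0 S'S; apply: min => //; apply: submx_trans SU.
have [j [Q1 [Q2 [Q12 Q21 QE]]]] := compl _ _ simB'.
have [pr [prC prS Spr]] := tga_maschke modB invS.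
rewrite -(subrK (x *m pr) x); apply: (subspaceD sP).
  apply: (IHr (U *m (1%:M - pr))).
  - rewrite -ltnS; apply: leq_trans leUr; rewrite ltnS; apply: rank_ltmx.
    have prU := submx_trans prS SU.
    rewrite ltmxE; apply/andP; split.
      rewrite mulmxBr mulmx1; apply: addmx_sub => //.
      by rewrite eqmx_opp; apply: mulmx_sub.
    apply: contra S0 => subU'; have /submxP[D DE] := submx_trans SU subU'.
    rewrite -Spr DE -!mulmxA mulmxBl mul1mx.
    have -> : pr *m pr = pr.
      by have /submxP[E prE] := prS; rewrite {1}prE -mulmxA Spr -prE.
    by rewrite subrr !mulmx0.
  - move=> h hG; rewrite -mulmxA mulmxBl mul1mx -prC // -{1}[B h]mulmx1 -mulmxBr mulmxA.
    by apply: submxMr; apply: invU.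
  - by rewrite -{1}[x]mulmx1 -mulmxBr; apply: submxMr.
have /submxP[y ->] : (x *m pr <= row_base S)%MS.
  by rewrite eq_row_base; apply: submx_trans (submxMl _ _) prS.
have -> : y *m row_base S = (y *m Q1) *m (Q2 *m row_base S).
  by rewrite [RHS]mulmxA -[y *m Q1 *m Q2]mulmxA Q12 mulmx1.
apply: PX => h hG; rewrite -mulmxA -BE // [LHS]mulmxA [RHS]mulmxA; congr (_ *m _).
by rewrite -[RHS]mulmx1 -Q12 mulmxA -[_ *m B' h *m Q1]mulmxA QE // mulmxA Q21 mul1mx.
Qed.

End TwistedGroupAlgebra.

(** * The action of the stabilizer on an irreducible twisted module *)

Section Orbifold.
Variables (R : realType) (V : lmodType (complex R)) (Y : V -> int -> V -> V).
Variables (one om : V) (gT : finGroupType) (G : {group gT}).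
Variables (act : gT -> V -> V) (g : gT).
Local Notation C := (complex R).
Local Notation T := (tord g).
Variables (M : lmodType C) (Ym : V -> int -> M -> M).
Hypotheses (simpV : simple_VOA Y one om) (autG : aut_group Y one om G act).
Hypotheses (gZ : g \in 'Z(G)%g).
Hypotheses (irrM : irreducible_twisted_module Y one om act g Ym).
Local Notation GM := (stab_mod act Ym G).

Lemma act_aut h : h \in G -> is_aut Y one om (act h).
Proof. by case: autG => H _ _ _; apply: H. Qed.

Lemma act_lin h : h \in G -> linmap (act h).
Proof. by move/act_aut; case. Qed.

Lemma actM h k v : h \in G -> k \in G -> act (h * k)%g v = act h (act k v).
Proof. by case: autG => _ _ H _; apply: H. Qed.

Lemma act1 v : act 1%g v = v.
Proof. by case: autG. Qed.

Lemma actK h v : h \in G -> act h (act h^-1%g v) = v.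
Proof. by move=> hG; rewrite -actM ?groupV // mulgV act1. Qed.

Lemma center_in : g \in G.
Proof. by case/centerP: gZ. Qed.

Lemma iter_center v : iter T (act g) v = v.
Proof.
suff H j : iter j (act g) v = act (g ^+ j)%g v by rewrite H expg_order act1.
by elim: j => [|j IHj]; rewrite ?expg0 ?act1 // expgS actM ?groupX ?center_in //= IHj.
Qed.

Lemma VOA_bilin : bilin_op Y.
Proof. by case: simpV => [[[bY _] _ _ _ _] _]. Qed.

Lemma VOA_truncated : truncated Y.
Proof. by case: simpV => [[[_ tY] _ _ _ _] _]. Qed.

Lemma irr_weak : weak_twisted_module Y one act g Ym.
Proof. by case: irrM => [[]]. Qed.

Lemma irr_neq0 : exists w : M, w != 0.
Proof. by case: irrM => [_ [_ [w [_ /eqP w0]] _]]; exists w. Qed.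

Lemma irr_submod (Q : M -> Prop) : subspace Q ->
  (forall u k w, Q w -> Q (Ym u k w)) -> (forall w, Q w -> w = 0) \/ forall w, Q w.
Proof.
move=> sQ mQ; case: irrM => [_ [_ _ /(_ Q)]] [||H|H]; first by split=> // u k w _; apply: mQ.
- by [].
- by left.
- by right=> w; apply: H.
Qed.

(** [F] commutes with [L(0)], hence has an eigenvector in one of its finite-dimensional eigenspaces;
    the vectors with that eigenvalue form a nonzero submodule. *)
Lemma schur (F : M -> M) : linmap F -> (forall u k w, F (Ym u k w) = Ym u k (F w)) ->
  exists c, forall w, F w = c *: w.
Proof.
move=> lF comF; have [w0 w00] := irr_neq0.
have [[_ ss fd _] _] := irrM.
have [s [sE w0E]] := ss w0.
have [x xs x0] : exists2 x, x \in s & x.2 != 0.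
  have [|/hasPn s0] := boolP (has (fun x => x.2 != 0) s); first by case/hasP=> x; exists x.
  move: w00; rewrite w0E big_seq big1 ?eqxx // => x /s0.
  by rewrite negbK => /eqP.
have [|v v0 [c vE]] := eigenvector_exists (fd x.1) lF _ (sE x xs) x0.
  by move=> v; rewrite /Meig /Lm0 -comF => ->; rewrite linmapZ.
exists c; have lm u k := mode_linr irr_weak u k.
have [|u k w wE|all0|//] := @irr_submod (fun w => F w = c *: w).
- split=> [|a w1 w2 E1 E2]; first by rewrite linmap0 // scaler0.
  by rewrite lF E1 E2 scalerDr !scalerA mulrC.
- by rewrite comF wE linmapZ.
- by rewrite (all0 _ vE) eqxx in v0.
Qed.

(** Kernel and image of a homomorphism between two twists of [M] are submodules, so a nonzero one is
    bijective. *)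
Lemma hom_twist h h' (F : M -> M) : h \in G -> h' \in G -> linmap F ->
  (forall u k w, F (Ym (act h u) k w) = Ym (act h' u) k (F w)) ->
  (forall w, F w = 0) \/ GM (h * h'^-1)%g.
Proof.
move=> hG h'G lF comF; have lm u k := mode_linr irr_weak u k.
have comF1 u k w : F (Ym u k w) = Ym (act (h' * h^-1)%g u) k (F w).
  by rewrite actM ?groupV // -comF actK.
have comF2 u k w : Ym u k (F w) = F (Ym (act (h * h'^-1)%g u) k w).
  by rewrite comF1 -actM ?groupM ?groupV // mulgA mulgKV mulgV act1.
have [|u k w w0|inj|//] := @irr_submod (fun w => F w = 0); last by left.
- split=> [|a w1 w2 E1 E2]; first exact: linmap0.
  by rewrite lF E1 E2 scaler0 addr0.
- by rewrite comF1 w0 linmap0.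
have [|u k _ [w <-]|im0|surj] := @irr_submod (fun w => exists v, F v = w).
- split=> [|a _ _ [w1 <-] [w2 <-]]; first by exists 0; apply: linmap0.
  by exists (a *: w1 + w2); rewrite lF.
- by exists (Ym (act (h * h'^-1)%g u) k w); rewrite comF2.
- by left=> w; apply: im0; exists w.
right; split; first by rewrite groupM ?groupV.
exists F; split=> //.
have [F' F'K] := choice surj; exists F' => // w.
by apply: (linmap_injective lF inj); rewrite F'K.
Qed.

(** * Density on finite direct sums of twists of M *)

Section TwistedSum.
Variables (I : finType) (s : I -> gT).
Hypothesis sG : forall i, s i \in G.

Definition twisted_sum (u : V) (k : int) (y : {ffun I -> M}) : {ffun I -> M} :=
  [ffun i => Ym (act (s i) u) k (y i)].

(** Centrality of [g] enters here: every [act (s i)] preserves the eigenspaces [V^r]. *)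
Lemma twisted_sum_weak : weak_twisted_module Y one act g twisted_sum.
Proof.
have linr := mode_linr irr_weak; have linl := mode_linl irr_weak.
have [gG gC] : g \in G /\ forall h, h \in G -> commute g h by case/centerP: gZ.
have sVr r i u : Vr act g r u -> Vr act g r (act (s i) u).
  move=> ur; rewrite /Vr -actM // gC // actM // ur linmapZ //.
  exact: act_lin.
split.
- split=> [k a u1 u2 y|u k a y1 y2]; apply/ffunP=> i; rewrite !ffunE.
    by rewrite act_lin // linl.
  by rewrite linr.
- move=> u y; have [N HN] : exists N : nat, forall i k, N%:Z <= k ->
      Ym (act (s i) u) k (y i) = 0.
    apply: uniform_int_bound => i.
    by have [N HN] := mode_truncated irr_weak (act (s i) u) (y i); exists N.
  by exists N => n leN; apply/ffunP=> i; rewrite !ffunE HN.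
- move=> r u k y ltrT ur kr; apply/ffunP=> i; rewrite !ffunE.
  exact: (mode_grade irr_weak _ ltrT (sVr _ _ _ ur) kr).
- move=> k y; apply/ffunP=> i; rewrite ffunE; have [_ _ _ -> _] := act_aut (sG i).
  have [_ _ _ -> _] := irr_weak; by case: eqP; rewrite ?ffunE.
move=> r u v y m n p ltrT ur mr; have [_ _ _ _ jac] := irr_weak.
have [N HN] := uniform_nat_bound (fun i => jac r (act (s i) u) (act (s i) v) (y i)
  m n p ltrT (sVr _ i _ ur) mr).
exists N => K leK; apply/ffunP => i; have := HN i K leK.
rewrite !sum_ffunE => E; etransitivity; last (etransitivity; first exact: E).
  apply: eq_bigr => j _; rewrite !ffunE; congr (_ *: Ym _ _ _).
  by have [_ _ -> _ _] := act_aut (sG i).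
by apply: eq_bigr => j _; rewrite !ffunE.
Qed.

(** Repeated values of [s] allow several vectors in one twist. A relation from [goursat] on the
    submodule generated by [y] would hold at [y] itself, against independence. *)
Lemma density (y : {ffun I -> M}) :
  (forall i i', GM (s i * (s i')^-1)%g -> s i = s i') ->
  (forall i0 c, c i0 != 0 -> (forall i, c i != 0 -> s i = s i0) ->
     \sum_i c i *: y i <> 0) ->
  forall z : I -> M, exists q : seq (V * int),
    forall i, \sum_(p <- q) Ym (act (s i) p.1) p.2 (y i) = z i.
Proof.
move=> sep indep z.
have lin_g := act_lin center_in.
have [sQ mQ] := mode_span_submod lin_g iter_center twisted_sum_weak y.
pose op i (j : V * int) := Ym (act (s i) j.1) j.2.
have linop i j : linmap (op i j) by apply: mode_linr irr_weak _ _.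
have [i Q sub|i i' F lF comF|j x Qx|[i0 [c [c0 cE relQ]]]|/(_ z)[x [[q ->] qz]]] :=
  goursat (e := fun i i' => s i = s i') (fun=> erefl) linop _ _ sQ _ [set: I].
- move=> opQ; apply: irr_submod => // u k w Qw.
  by rewrite -[u](actK u (sG i)); apply: (opQ (act (s i)^-1%g u, k)).
- have [|F0|/sep ss'] := hom_twist (sG i) (sG i') lF.
  + by move=> u k w; apply: (comF (u, k)).
  + by exists 0; split=> [w|]; [rewrite F0 scale0r | right].
  have [|c cE] := schur lF; last by exists c; split=> //; left.
  move=> u k w; rewrite -[u](actK u (sG i)) (comF (act (s i)^-1%g u, k)).
  by rewrite /op -ss'.
- exact: (mQ j.1 j.2).
- case: (indep i0 c c0) => [i /cE[]//|].
  by apply: relQ; apply: mode_span_refl twisted_sum_weak y.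
exists q => i; rewrite -qz ?inE // sum_ffunE.
by apply: eq_bigr => p _; rewrite ffunE.
Qed.

End TwistedSum.

(** * The projective action of the stabilizer *)

Variables (phi : gT -> M -> M) (alpha : gT -> gT -> C).
Hypothesis phiP : forall h, GM h -> phi_ok act Ym (phi h) h.
Hypothesis phi1 : forall w, phi 1%g w = w.
Hypothesis phiM : forall h k, GM h -> GM k ->
  forall w, phi h (phi k w) = alpha h k *: phi (h * k)%g w.

Lemma stab_in h : GM h -> h \in G. Proof. by case. Qed.

Lemma stab1 : GM 1%g.
Proof.
split; first exact: group1.
by exists id; split=> // [|v k w]; [exists id | rewrite act1].
Qed.

Lemma stabM h k : GM h -> GM k -> GM (h * k)%g.
Proof.
move=> [hG [F [lF bF FP]]] [kG [F' [lF' bF' FP']]]; split; first exact: groupM.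
exists (F' \o F); split=> [||v j w /=]; first exact: linmap_comp.
  exact: bij_comp.
by rewrite actM // FP FP'.
Qed.

Lemma stabV h : GM h -> GM h^-1%g.
Proof.
move=> [hG [F [lF [F' FK F'K] FP]]]; split; first by rewrite groupV.
exists F'; split=> [||v k w]; first exact: linmap_inv lF FK F'K.
  by exists F.
by rewrite -{1}(F'K w) -FP actK.
Qed.

Lemma phi_lin h : GM h -> linmap (phi h). Proof. by case/phiP. Qed.

Lemma phi_inj h : GM h -> injective (phi h).
Proof. by case/phiP=> _ /bij_inj. Qed.

Lemma phi_eq0 h w : GM h -> phi h w = 0 -> w = 0.
Proof. by move=> hS w0; apply: (phi_inj hS); rewrite w0 linmap0 //; apply: phi_lin. Qed.

Lemma phi_mode h v k w : GM h -> phi h (Ym v k w) = Ym (act h v) k (phi h w).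
Proof. by case/phiP. Qed.

Lemma alpha_neq0 h k : GM h -> GM k -> alpha h k != 0.
Proof.
move=> hS kS; have [w w0] := irr_neq0; apply: contraNneq w0 => a0.
by have := phiM hS kS w; rewrite a0 scale0r => /(phi_eq0 hS)/(phi_eq0 kS)->.
Qed.

Lemma act_faithful h k : h \in G -> k \in G -> (forall v, act h v = act k v) -> h = k.
Proof.
case: autG => _ _ _ faith hG kG eq_hk; apply/eqP; rewrite eq_mulVg1; apply/eqP.
apply: faith => [|v]; first by rewrite groupM ?groupV.
by rewrite actM ?groupV // -eq_hk -actM ?groupV // mulVg act1.
Qed.

(* A shortest relation would, by Goursat's lemma applied to the submodule
   {y | forall u k, sum_h c_h (hu)_k y_h = 0} of M^G containing all (phi(h)w)_h,
   force hu - h'u to annihilate M for two distinct h, h' of its support. *)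
Lemma phi_independent (c : gT -> C) : (forall h, c h != 0 -> GM h) ->
  (forall w, \sum_h c h *: phi h w = 0) -> forall h, c h = 0.
Proof.
have [n] := ubnP #|[set h | c h != 0]|; elim: n c => // n IHn c lecn cS rel0 h0.
apply/eqP; apply: contraT => ch0; have h0S := cS _ ch0.
have linl k w := mode_linl irr_weak k w; have linr u k := mode_linr irr_weak u k.
pose P (y : {ffun gT -> M}) := forall u k, \sum_h c h *: Ym (act h u) k (y h) = 0.
have [||||||] := @goursat R M gT (V * int)%type (fun _ j => Ym j.1 j.2)
    (fun _ _ => True) (fun=> I) _ _ _ P _ _ ([set h | c h != 0] :\ h0).
- by move=> i j; apply: linr.
- by move=> _ Q sQ mQ; apply: irr_submod => // u k; apply: (mQ (u, k)).
- move=> _ _ F lF comF; have [u k w|a aE] := schur lF; first exact: (comF (u, k)).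
  by exists a; split=> //; left.
- split=> [u k|a y1 y2 P1 P2 u k].
    by apply: big1 => h _; rewrite ffunE linmap0 ?scaler0 //; apply: linr.
  transitivity (a *: (\sum_h c h *: Ym (act h u) k (y1 h))
                + \sum_h c h *: Ym (act h u) k (y2 h)).
    2: by rewrite P1 P2 scaler0 addr0.
  rewrite scaler_sumr -big_split; apply: eq_bigr => h _ /=.
  by rewrite !ffunE linr scalerDr !scalerA mulrC.
- move=> [u a] y Py v k.
  under eq_bigr => h _ do rewrite -(linmapZ (c h) _ (linl _ _)) ffunE.
  apply: (mode_kernel_stable VOA_truncated (act_lin center_in) iter_center irr_weak).
  move=> b; rewrite -[RHS](Py v b); apply: eq_bigr => h _.
  exact: (linmapZ (c h) _ (linl _ _)).
- case=> i0 [d [di0 dA relP]].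
  have lt_dc : (#|[set h | d h != 0%R]| < n)%N.
    apply: leq_trans (_ : (#|[set h | c h != 0%R]| <= n)%N); last by [].
    rewrite (cardsD1 h0 [set h | c h != 0]) inE ch0 add1n ltnS.
    by apply/subset_leq_card/subsetP => h; rewrite inE => /dA[].
  suff d0 : d i0 = 0 by rewrite d0 eqxx in di0.
  apply: (IHn d lt_dc) => [h /dA[]|w]; first by rewrite !inE => /andP[_ /cS].
  rewrite -[RHS](relP [ffun h => phi h w]) => [|u k].
    by apply: eq_bigr => h _; rewrite ffunE.
  rewrite -[RHS](rel0 (Ym u k w)); apply: eq_bigr => h _; rewrite ffunE.
  by have [->|/cS hS] := eqVneq (c h) 0; rewrite ?scale0r ?phi_mode.
move=> surj.
have c_off h : h \notin [set h | c h != 0] -> c h = 0.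
  by rewrite inE negbK => /eqP.
have [A0|[h1]] := set_0Vmem ([set h | c h != 0] :\ h0).
  have [w w0] := irr_neq0; have := rel0 w; rewrite (bigD1 h0) //= big1 => [|h neq_h].
    rewrite addr0 => /eqP; rewrite scaler_eq0 (negPf ch0) /= => /eqP.
    by move/(phi_eq0 h0S)=> w0'; rewrite w0' eqxx in w0.
  rewrite c_off ?scale0r //; apply/negP => hA.
  by have := in_set0 h; rewrite -A0 inE hA andbT inE neq_h.
rewrite !inE => /andP[neq_h10 ch1]; have h1S := cS _ ch1.
suff eq_act u : act h1 u = act h0 u.
  by rewrite (act_faithful (stab_in h1S) (stab_in h0S) eq_act) eqxx in neq_h10.
have [w w0] := irr_neq0; apply/eqP; rewrite -subr_eq0; apply/eqP.
apply: (annihilates_eq0 VOA_bilin VOA_truncated (act_lin center_in) iter_center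
  irr_weak simpV w0) => k m.
(* In the relation defining [P], this [y] leaves only the terms at [h1] and [h0]. *)
have [y [Py yA]] := surj (fun h => if h == h1 then m else 0).
have two v b : c h1 *: Ym (act h1 v) b m + c h0 *: Ym (act h0 v) b (y h0) = 0.
  rewrite -(Py v b) (bigD1 h0) //= (bigD1 h1) //= big1 => [|h /andP[neq0 neq1]].
    by rewrite addr0 addrC (yA h1) ?eqxx // !inE neq_h10.
  have [->|ch] := eqVneq (c h) 0; first by rewrite scale0r.
  by rewrite yA ?(negPf neq1) ?(linmap0 (linr _ _)) ?scaler0 // !inE neq0.
have act_one h : h \in G -> act h one = one by case/act_aut.
(* The vacuum mode ties [y h0] to [m]. Applying a mode of [act h0 u] to this and comparing with
   [two] eliminates [y h0]. *)
have := two one (- T%:Z); rewrite !act_one ?stab_in // !(mode_one irr_weak) => rel1.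
have rel2 : c h1 *: Ym (act h0 u) k m + c h0 *: Ym (act h0 u) k (y h0) = 0.
  by rewrite -(linmapZ (c h0) _ (linr _ _)) -linr rel1 (linmap0 (linr _ _)).
have /addIr/eqP := etrans (two u k) (esym rel2).
rewrite -subr_eq0 -scalerBr scaler_eq0 (negPf ch1) /= => /eqP <-.
by rewrite (linmapB (act h1 u) (act h0 u) (linl k m)).
Qed.

Definition phi_inv h w := (alpha h h^-1%g)^-1 *: phi h^-1%g w.

Lemma phi_invK h w : GM h -> phi h (phi_inv h w) = w.
Proof.
move=> hS; have hVS := stabV hS; rewrite linmapZ ?phiM //; last exact: phi_lin.
by rewrite mulgV phi1 scalerA mulVf ?scale1r // alpha_neq0.
Qed.

Definition stab_set := [set h | `[< GM h >]].

Lemma in_stab h : (h \in stab_set) = `[< GM h >]. Proof. by rewrite inE. Qed.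

Lemma stab_setP h : reflect (GM h) (h \in stab_set).
Proof. by rewrite in_stab; apply: asboolP. Qed.

Lemma stab_group_set : group_set stab_set.
Proof.
apply/group_setP; split=> [|h k /stab_setP hS /stab_setP kS]; apply/stab_setP.
  exact: stab1.
exact: stabM.
Qed.

Canonical stab_group := Group stab_group_set.

(** Averages the rank-one map sending [x] to [x 0 j0 *: m]. If all these averages vanished,
    evaluation at the basis vector [j0] would give a relation among the [phi h] whose coefficient at
    1 is the inverse of [alpha 1 1]. *)
Lemma tga_hom_exists n (A : gT -> 'M[C]_n) : tga_mod GM alpha A -> (0 < n)%N ->
  exists2 f, tga_hom GM phi A f & exists x, f x != 0.
Proof.
move=> [A1 AM] n0; pose j0 := Ordinal n0.
pose f m (x : 'rV[C]_n) := \sum_(h in stab_set) (x *m A h) 0 j0 *: phi_inv h m.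
have f_hom m : tga_hom GM phi A (f m).
  split=> [a x y|k x kS].
    rewrite /f scaler_sumr -big_split; apply: eq_bigr => h _ /=.
    by rewrite mulmxDl -scalemxAl mxE [X in (X + _) *: _]mxE scalerDl -scalerA.
  rewrite /f (linmap_sum _ _ _ (phi_lin kS)) (reindex_inj (mulIg k^-1%g)) /=.
  have kH : k \in stab_set by apply/stab_setP.
  apply: eq_big => [h|h hkH]; first by rewrite (groupMr h (x := _)) ?groupV.
  have hkS := stab_setP _ hkH; have hS : GM h by have := stabM hkS kS; rewrite mulgKV.
  rewrite (linmapZ _ _ (phi_lin kS)) -mulmxA AM // mulgKV -scalemxAr mxE mulrC -scalerA; congr (_ *: _).
  apply: (phi_inj hkS); rewrite phiM // mulgKV phi_invK //.
  by rewrite (linmapZ _ _ (phi_lin hkS)) phi_invK.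
apply: contrapT => no_f.
have f0 m x : f m x = 0.
  by apply/eqP; apply: contraT => fx; case: no_f; exists (f m) => //; exists x.
pose c h := if h \in stab_set then A h^-1%g j0 j0 / alpha h^-1%g h else 0.
have c0 : c 1%g = 0.
  apply: phi_independent => [h|m].
    by rewrite /c; case: ifP => [/stab_setP//|]; rewrite eqxx.
  rewrite -[RHS](f0 m (delta_mx 0 j0)) /f [RHS](reindex_inj invg_inj) [RHS]big_mkcond.
  apply: eq_bigr => h _ /=; rewrite /c groupV.
  case: ifP => hH; last by rewrite scale0r.
  by rewrite -rowE mxE /phi_inv invgK scalerA.
move: c0; rewrite /c group1 invg1 A1 mxE eqxx div1r => /eqP.
by rewrite invr_eq0 (negPf (alpha_neq0 stab1 stab1)).
Qed.

(** * Irreducibility of the multiplicity spaces *)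

Section SimpleHom.
Variables (n : nat) (A : gT -> 'M[C]_n).
Hypothesis simpA : tga_simple GM alpha A.

Lemma simple_hom_inj f : tga_hom GM phi A f -> (exists x, f x != 0) ->
  forall x, f x = 0 -> x = 0.
Proof.
move=> [lf fA] [x0 fx0] x fx; have [_ _ simp] := simpA.
have [|U UP] := @subspace_rowspace R n (fun x => f x = 0).
  split=> [|a y z y0 z0]; first exact: linmap0.
  by rewrite lf y0 z0 scaler0 addr0.
have /orP[|/submx_full full] : (\rank U == 0)%N || row_full U.
- apply: simp => h hS; apply/row_subP => i; rewrite row_mul; apply/UP.
  by rewrite fA // (proj1 (UP _)) ?row_sub // linmap0 //; apply: phi_lin.
- rewrite mxrank_eq0 => /eqP U0; move/UP: fx; rewrite U0.
  by rewrite submx0 => /eqP.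
- by have /UP := full _ x0; move/eqP; rewrite (negPf fx0).
Qed.

(** Evaluation at [w] thus identifies the space of homomorphisms from [W_lambda] to [M] with
    [M_lambda]. *)
Lemma simple_hom_unique f1 f2 w : tga_hom GM phi A f1 -> tga_hom GM phi A f2 ->
  w != 0 -> f1 w = f2 w -> forall x, f1 x = f2 x.
Proof.
move=> [lf1 f1A] [lf2 f2A] w0 eqw x; apply/eqP; rewrite -subr_eq0; apply: contraT => fx.
suff /eqP : w = 0 by rewrite (negPf w0).
apply: (@simple_hom_inj (fun x => f1 x - f2 x)); last 1 first.
- by rewrite eqw subrr.
- split=> [a y z|h y hS]; first by rewrite lf1 lf2 scalerBr opprD addrACA.
  by rewrite f1A // f2A // linmapB //; apply: phi_lin.
- by exists x.
Qed.

Lemma simple_mx_surj k : GM k -> forall y, exists x : 'rV_n, y = x *m A k.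
Proof.
move=> kS y; have [[A1 AM] _ _] := simpA; have kVS := stabV kS.
exists ((alpha k k^-1%g)^-1 *: y *m A k^-1%g); rewrite -mulmxA AM // mulgV A1.
by rewrite -scalemxAl -scalemxAr scalerA mulVf ?alpha_neq0 // scale1r mulmx1.
Qed.

(** Right cosets are the right choice, as [hom_twist] compares two twists through [h * h'^-1]. *)
Definition coset_rep x := repr (stab_group :* x)%g.

Lemma coset_repP x : GM (x * (coset_rep x)^-1)%g.
Proof.
have := mem_repr_rcoset stab_group x; rewrite mem_rcoset => /groupVr.
by rewrite invMg invgK => /stab_setP.
Qed.

Lemma coset_rep_eq x y : GM (x * y^-1)%g -> coset_rep x = coset_rep y.
Proof.
move/stab_setP => xy; congr repr; apply/rcoset_eqP.
by rewrite mem_rcoset.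
Qed.

Lemma coset_rep_id x : coset_rep (coset_rep x) = coset_rep x.
Proof. by rewrite {1}/coset_rep rcoset_repr. Qed.

Lemma coset_rep_in x : x \in G -> coset_rep x \in G.
Proof.
by move=> xG; rewrite -groupV -(groupMl _ xG) (stab_in (coset_repP x)).
Qed.

(* Density on the direct sum of the M o x, x over coset representatives of G_M,
   gives modes acting as f' f^-1 on M and as 0 on f(W) in the other summands;
   averaging the vectors over G then makes them G-invariant. *)
Lemma simple_hom_density f f' : tga_hom GM phi A f -> (exists x, f x != 0) ->
  tga_hom GM phi A f' ->
  exists q : seq (V * int), (forall p, p \in q -> fixed_pts G act p.1) /\
    forall y, \sum_(p <- q) Ym p.1 p.2 (f y) = f' y.
Proof.
move=> fH fn0 [lf' f'A]; have [lf fA] := fH; have injf := simple_hom_inj fH fn0.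
pose X := [set coset_rep x | x in G].
have XP x : x \in X -> x \in G /\ coset_rep x = x.
  by case/imsetP=> y yG ->; rewrite coset_rep_id coset_rep_in.
pose I := ({x : gT | x \in X} * 'I_n)%type.
pose s (i : I) := val i.1.
have expand (F : 'rV[C]_n -> M) y : linmap F ->
    F y = \sum_j y 0 j *: F (delta_mx 0 j).
  move=> lF; rewrite {1}[y]row_sum_delta linmap_sum //.
  by apply: eq_bigr => j _; rewrite linmapZ.
have [i|i i'|i0 c c0 cE rel|q qE] := @density I s _ [ffun i => f (delta_mx 0 i.2)] _ _
  (fun i => if s i == coset_rep 1%g then f' (delta_mx 0 i.2) else 0).
- by have [] := XP _ (valP i.1).
- move/coset_rep_eq; have [_ ->] := XP _ (valP i.1); by have [_ ->] := XP _ (valP i'.1).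
- have /injf/rowP/(_ i0.2) : f (\row_j c (i0.1, j)) = 0.
    rewrite -[RHS]rel (expand f) //.
    rewrite (eq_bigr (fun i => c (i.1, i.2) *: f (delta_mx 0 i.2))); last first.
      by case=> x j _; rewrite ffunE.
    rewrite -(pair_bigA _ (fun x j => c (x, j) *: f (delta_mx 0 j))) /=.
    rewrite (bigD1 i0.1) //= [X in _ + X]big1 ?addr0 => [|x neq_x].
      by apply: eq_bigr => j _; rewrite mxE.
    apply: big1 => j _; have [->|/cE/val_inj/= E] := eqVneq (c (x, j)) 0.
      exact: scale0r.
    by rewrite E eqxx in neq_x.
  by rewrite !mxE -surjective_pairing => ci0; rewrite ci0 eqxx in c0.
have {}qE x y : x \in X -> \sum_(p <- q) Ym (act x p.1) p.2 (f y) =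
    if x == coset_rep 1%g then f' y else 0.
  move=> xX; have linS : linmap (fun w => \sum_(p <- q) Ym (act x p.1) p.2 w).
    move=> a w1 w2; rewrite scaler_sumr -big_split; apply: eq_bigr => p _ /=.
    exact: (mode_linr irr_weak).
  rewrite (expand _ y (linmap_comp linS lf)).
  rewrite (eq_bigr (fun j => y 0 j *: if x == coset_rep 1%g then f' (delta_mx 0 j)
    else 0)) => [|j _]; last first.
    by have := qE (exist _ x xX, j); rewrite ffunE /s /= => ->.
  by case: ifP => _; [rewrite -expand | rewrite big1 // => j _; rewrite scaler0].
(* The number of [h] in [G] whose term contributes [f' y] to the average; the other cosets
   contribute 0. *)
pose b : C := #|[set h in G | coset_rep h == coset_rep 1%g]|%:R.
have b0 : b != 0.
  rewrite pnatr_eq0 -lt0n; apply/card_gt0P; exists 1%g.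
  by rewrite inE group1 eqxx.
exists [seq (b^-1 *: \sum_(h in G) act h p.1, p.2) | p <- q]; split=> [p /mapP[p' _ ->] k kG|y].
  rewrite /= (linmapZ _ _ (act_lin kG)) (linmap_sum _ _ _ (act_lin kG)).
  congr (_ *: _); rewrite [RHS](reindex_inj (mulgI k)) /=.
  by apply: eq_big => [h|h hG]; [rewrite groupMl | rewrite actM].
rewrite big_map /=.
have linl k w := mode_linl irr_weak k w.
under eq_bigr => p _ do rewrite (linmapZ _ _ (linl _ _)) (linmap_sum _ _ _ (linl _ _)).
rewrite -scaler_sumr exchange_big /=.
rewrite (eq_bigr (fun h => if coset_rep h == coset_rep 1%g then f' y else 0)).
  rewrite -big_mkcondr /= sumr_const -[_ *+ _]scaler_nat scalerA.
  rewrite (_ : #|_| = #|[set h in G | coset_rep h == coset_rep 1%g]|).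
    by rewrite mulVf ?scale1r.
  by apply: eq_card => h; rewrite inE.
(* Write [h = k x] with [k] in the stabilizer and [y = y' A_k]: then [phi k] can be pulled out of
   the sum, leaving the case of the representative [x]. *)
move=> h hG; set x := coset_rep h; set k := (h * x^-1)%g.
have kS : GM k := coset_repP h.
have xG : x \in G by apply: coset_rep_in.
have [y' ->] := simple_mx_surj kS y.
rewrite fA // f'A //.
have xX : x \in X by apply: imset_f.
have -> : h = (k * x)%g by rewrite mulgKV.
under eq_bigr => p _ do rewrite actM ?(stab_in kS) // -(phi_mode _ _ _ kS).
rewrite -(linmap_sum _ _ _ (phi_lin kS)) qE //.
by case: ifP => // _; apply: linmap0 (phi_lin kS).
Qed.

(** A nonzero element is [f w] with [f] nonzero and any other is [f' w], so density carries the
    first to the second by modes of [V^G]. *)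
Lemma Mlam_irreducible w : w != 0 ->
  irreducible_on Ym (fixed_pts G act) (Mlam GM phi A w).
Proof.
move=> w0; have [modA n0 _] := simpA; split.
- split=> [|u k _ fixu [f [[lf fA] ->]]].
    split=> [|a _ _ [f1 [[lf1 f1A] ->]] [f2 [[lf2 f2A] ->]]].
      exists (fun _ => 0); split=> //; split=> [a x y|h x hS].
        by rewrite scaler0 addr0.
      by rewrite linmap0 //; apply: phi_lin.
    exists (fun x => a *: f1 x + f2 x); split=> //; split=> [b x y|h x hS].
      by rewrite lf1 lf2 !scalerDr !scalerA [a * b]mulrC addrACA.
    by rewrite f1A // f2A // phi_lin.
  exists (fun x => Ym u k (f x)); split=> //; split=> [|h x hS].
    exact: linmap_comp (mode_linr irr_weak u k) lf.
  by rewrite fA // phi_mode // fixu //; apply: stab_in.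
- have [f fH fn0] := tga_hom_exists modA n0.
  exists (f w); split; first by exists f.
  by move/(simple_hom_inj fH fn0)/eqP; rewrite (negPf w0).
move=> Q [sQ mQ] QP.
have [|Qn0] := pselect (forall w, Q w -> w = 0); [by left | right].
have [m [Qm m0]] : exists m, Q m /\ m <> 0.
  by apply: contrapT => none; apply: Qn0 => m Qm; apply: contrapT => m0; apply: none; exists m.
have [f [fH mE]] := QP m Qm.
move=> _ [f' [f'H ->]].
have [|q [qfix qE]] := simple_hom_density fH _ f'H.
  by exists w; rewrite -mE; apply/eqP.
rewrite -qE -mE big_seq; apply: (subspace_sum _ sQ) => p /qfix fixp.
exact: mQ.
Qed.

End SimpleHom.

Lemma alpha_stab_neq0 h k : h \in stab_group -> k \in stab_group -> alpha h k != 0.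
Proof. by move=> /stab_setP hS /stab_setP kS; apply: alpha_neq0. Qed.

(** Associativity of composition of the [phi], compared on a nonzero vector; it makes [regular_tga]
    a module. *)
Lemma alpha_cocycle h k l : GM h -> GM k -> GM l ->
  alpha k l * alpha h (k * l)%g = alpha h k * alpha (h * k)%g l.
Proof.
move=> hS kS lS; have [w w0] := irr_neq0.
have klS := stabM kS lS; have hkS := stabM hS kS.
have E : (alpha k l * alpha h (k * l)%g) *: phi (h * k * l)%g w =
         (alpha h k * alpha (h * k)%g l) *: phi (h * k * l)%g w.
  rewrite -scalerA -mulgA -phiM // -(linmapZ _ _ (phi_lin hS)) -phiM // phiM //.
  by rewrite phiM // scalerA mulgA.
apply/eqP; rewrite -subr_eq0; move/eqP: E; rewrite -subr_eq0 -scalerBl scaler_eq0.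
by case/orP=> // /eqP/(phi_eq0 (stabM hkS lS)) w0'; rewrite w0' eqxx in w0.
Qed.

(** * Decomposition of M into isotypic components *)

Section Decomposition.
Variables (k : nat) (n : 'I_k -> nat) (A : forall j : 'I_k, gT -> 'M[C]_(n j)).
Variable w : forall j : 'I_k, 'rV[C]_(n j).
Hypotheses (complA : complete_simples GM alpha A) (w0 : forall j, w j != 0).

Let simpA j : tga_simple GM alpha (A j). Proof. by case: complA. Qed.

(** Apply [phi h] to the relation, weight it by an entry of the inverse of [A j0 h] and sum over
    [h]: Schur orthogonality isolates a multiple of [f j0 q] at one basis vector. *)
Lemma hom_family_independent (f : forall j, 'I_(n j) -> 'rV[C]_(n j) -> M) :
  (forall j i, tga_hom GM phi (A j) (f j i)) ->
  \sum_j \sum_i f j i (delta_mx 0 i) = 0 -> forall j i x, f j i x = 0.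
Proof.
move=> fH sum0 j0 q x.
have lf j i : linmap (f j i) by have [] := fH j i.
have [c c0 orth] := orthogonality_eq stab_setP alpha_stab_neq0 (simpA j0).
suff fe p : f j0 q (delta_mx 0 p) = 0.
  rewrite [x]row_sum_delta linmap_sum // big1 // => p _.
  by rewrite linmapZ // fe scaler0.
pose a h := invmx (A j0 h) p q.
have acted h : GM h -> \sum_j \sum_i \sum_t A j h i t *: f j i (delta_mx 0 t) = 0.
  move=> hS; transitivity (phi h (\sum_j \sum_i f j i (delta_mx 0 i))).
    2: by rewrite sum0 (linmap0 (phi_lin hS)).
  rewrite (linmap_sum _ _ _ (phi_lin hS)).
  apply: eq_bigr => j _; rewrite (linmap_sum _ _ _ (phi_lin hS)).
  apply: eq_bigr => i _; have [_ <- //] := fH j i.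
  rewrite -rowE [row _ _]row_sum_delta linmap_sum //.
  by apply: eq_bigr => t _; rewrite linmapZ // mxE.
have : \sum_j \sum_i \sum_t (\sum_(h in stab_group) a h * A j h i t) *:
    f j i (delta_mx 0 t) = 0.
  transitivity (\sum_(h in stab_group) a h *:
      \sum_j \sum_i \sum_t A j h i t *: f j i (delta_mx 0 t)); last first.
    by apply: big1 => h /stab_setP hS; rewrite acted // scaler0.
  under [RHS]eq_bigr => h _ do rewrite scaler_sumr.
  rewrite [RHS]exchange_big; apply: eq_bigr => j _ /=.
  under [RHS]eq_bigr => h _ do rewrite scaler_sumr.
  rewrite [RHS]exchange_big; apply: eq_bigr => i _ /=.
  under [RHS]eq_bigr => h _ do rewrite scaler_sumr.
  rewrite [RHS]exchange_big; apply: eq_bigr => t _ /=.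
  by rewrite scaler_suml; apply: eq_bigr => h _; rewrite scalerA.
rewrite (bigD1 j0) //= [X in _ + X]big1 => [|j neq_j]; last first.
  apply: big1 => i _; apply: big1 => t _.
  rewrite (orthogonality_neq stab_setP alpha_stab_neq0) ?scale0r // => iso.
  have [_ inj _] := complA.
  by rewrite (inj _ _ iso) eqxx in neq_j.
rewrite addr0 (bigD1 q) //= [X in _ + X]big1 => [|i neq_i]; last first.
  by apply: big1 => t _; rewrite orth (eq_sym q) (negPf neq_i) andbF mulr0 scale0r.
rewrite addr0 (bigD1 p) //= [X in _ + X]big1 => [|t neq_t]; last first.
  by rewrite orth (eq_sym p) (negPf neq_t) mulr0 scale0r.
rewrite addr0 orth !eqxx mulr1 => /eqP.
by rewrite scaler_eq0 (negPf c0) => /eqP.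
Qed.

Local Notation N := #|stab_group|.
Local Notation elt := (@enum_val _ (mem stab_group)).

(** The left regular module on the basis [elt i]. Each vector of [M] lies in its image under some
    [orbit_hom], which brings finite-dimensional semisimplicity to [M]. *)
Definition regular_tga (h : gT) : 'M[C]_N :=
  \matrix_(i, j) if elt j == (h * elt i)%g then alpha h (elt i) else 0.

Lemma elt_sum (W : lmodType C) x (F : 'I_N -> C) (v : 'I_N -> W) (i : 'I_N) :
  elt i = x -> \sum_j (if elt j == x then F j else 0) *: v j = F i *: v i.
Proof.
move=> ix; rewrite (bigD1 i) //= ix eqxx big1 ?addr0 // => j neq_j.
by rewrite -ix (inj_eq enum_val_inj) (negPf neq_j) scale0r.
Qed.

Lemma eltP i : GM (elt i). Proof. by apply/stab_setP; apply: enum_valP. Qed.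

Lemma elt_surj x : GM x -> exists i, elt i = x.
Proof. by move/stab_setP => xS; exists (enum_rank_in xS x); rewrite enum_rankK_in. Qed.

Lemma regular_tga_mod : tga_mod GM alpha regular_tga.
Proof.
split=> [|h l hS lS]; apply/matrixP => i j; rewrite !mxE.
  rewrite mul1g (inj_eq enum_val_inj) eq_sym; case: eqP => // _.
  have [v v0] := irr_neq0; have := phiM stab1 (eltP i) v; rewrite phi1 mul1g => /eqP.
  rewrite eq_sym -subr_eq0 -{2}[phi _ _]scale1r -scalerBl scaler_eq0 subr_eq0.
  by case/orP=> [/eqP//|/eqP/(phi_eq0 (eltP i))v0']; rewrite v0' eqxx in v0.
have [i' i'E] := elt_surj (stabM lS (eltP i)).
under eq_bigr => t _ do rewrite !mxE.
(* The matrix entries are viewed as vectors of [C^o], so that [elt_sum] applies. *)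
rewrite (elt_sum (fun=> alpha l (elt i)) (fun t =>
  (if elt j == (h * elt t)%g then alpha h (elt t) else 0) : C^o) i'E).
rewrite i'E mulgA; case: eqP => _; last by rewrite scaler0 mulr0.
by rewrite /GRing.scale /= alpha_cocycle //; apply: eltP.
Qed.

Definition orbit_hom (m : M) (x : 'rV[C]_N) := \sum_i x 0 i *: phi (elt i) m.

Lemma orbit_hom_hom m : tga_hom GM phi regular_tga (orbit_hom m).
Proof.
split=> [a x y|h x hS].
  rewrite /orbit_hom scaler_sumr -big_split; apply: eq_bigr => i _ /=.
  by rewrite !mxE scalerDl scalerA.
rewrite /orbit_hom (linmap_sum _ _ _ (phi_lin hS)).
under eq_bigr => j _ do rewrite mxE scaler_suml.
rewrite exchange_big; apply: eq_bigr => i _ /=.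
rewrite (linmapZ _ _ (phi_lin hS)) phiM //; last exact: eltP.
have [i' i'E] := elt_surj (stabM hS (eltP i)).
rewrite -i'E -(elt_sum (fun=> alpha h (elt i)) (fun j => phi (elt j) m) i'E).
by rewrite scaler_sumr; apply: eq_bigr => j _; rewrite scalerA mxE.
Qed.

Lemma orbit_hom_surj m : exists x, orbit_hom m x = m.
Proof.
have [i iE] := elt_surj stab1; exists (delta_mx 0 i).
rewrite /orbit_hom (bigD1 i) //= big1 => [|j neq_j].
  by rewrite addr0 mxE !eqxx scale1r iE phi1.
by rewrite mxE (negPf neq_j) andbF scale0r.
Qed.

Lemma Mlam_hom_choice : exists fs : forall j, M -> 'rV[C]_(n j) -> M,
  forall j m, Mlam GM phi (A j) (w j) m ->
    tga_hom GM phi (A j) (fs j m) /\ fs j m (w j) = m.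
Proof.
have /fin_all_exists[fs fsP] j : exists fs : M -> 'rV[C]_(n j) -> M,
    forall m, Mlam GM phi (A j) (w j) m ->
      tga_hom GM phi (A j) (fs m) /\ fs m (w j) = m.
  have [m|fs fsP] := @choice _ _ (fun m f => Mlam GM phi (A j) (w j) m ->
    tga_hom GM phi (A j) f /\ f (w j) = m); last by exists fs.
  have [[f [fH mE]]|no] := pselect (Mlam GM phi (A j) (w j) m); first by exists f.
  by exists (fun=> 0).
by exists fs.
Qed.

(** [Phi] is the evaluation map: a basis vector [e_i] of [W_j] tensored with [f (w j)] goes to
    [f e_i]. As [f] is determined by [f (w j)], linearity and both equivariances reduce to
    [fs_unique]. *)
Lemma isotypic_decomposition :
  let D (x : forall j, 'I_(n j) -> M) := forall j i, Mlam GM phi (A j) (w j) (x j i) in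
  exists Phi : (forall j, 'I_(n j) -> M) -> M,
  [/\ (forall (a : C) x y, D x -> D y ->
         Phi (fun j i => a *: x j i + y j i) = a *: Phi x + Phi y),
      (forall x y, D x -> D y -> Phi x = Phi y -> forall j i, x j i = y j i),
      (forall m, exists x, D x /\ Phi x = m),
      (forall h x, GM h -> D x ->
         Phi (fun j l => \sum_(i < n j) A j h i l *: x j i) = phi h (Phi x)) &
      (forall u (q : int) x, fixed_pts G act u -> D x ->
         Phi (fun j i => Ym u q (x j i)) = Ym u q (Phi x))].
Proof.
move=> D; have [fs fsP] := Mlam_hom_choice.
have irrL j := Mlam_irreducible (simpA j) (w0 j).
have sL j : subspace (Mlam GM phi (A j) (w j)) by have [[]] := irrL j.
have fs_unique j m f : tga_hom GM phi (A j) f -> f (w j) = m ->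
    forall x, fs j m x = f x.
  move=> fH fm; have [|fsH fsm] := fsP j m; first by exists f.
  by apply: (simple_hom_unique (simpA j) fsH fH (w0 j)); rewrite fsm.
have fs_lin j x : forall a m1 m2, Mlam GM phi (A j) (w j) m1 ->
    Mlam GM phi (A j) (w j) m2 -> fs j (a *: m1 + m2) x = a *: fs j m1 x + fs j m2 x.
  move=> a m1 m2 /fsP[[l1 H1] E1] /fsP[[l2 H2] E2].
  apply: (fs_unique j _ (fun x => a *: fs j m1 x + fs j m2 x)); last by rewrite E1 E2.
  split=> [b y z|h y hS].
    by rewrite l1 l2 !scalerDr !scalerA [a * b]mulrC addrACA.
  by rewrite H1 // H2 // phi_lin.
pose Phi (x : forall j, 'I_(n j) -> M) := \sum_j \sum_i fs j (x j i) (delta_mx 0 i).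
have Phi_lin (a : C) x y : D x -> D y ->
    Phi (fun j i => a *: x j i + y j i) = a *: Phi x + Phi y.
  move=> Dx Dy; rewrite /Phi scaler_sumr -big_split; apply: eq_bigr => j _ /=.
  by rewrite scaler_sumr -big_split; apply: eq_bigr => i _ /=; apply: fs_lin.
exists Phi; split=> // [x y Dx Dy|m|h x hS Dx|u q x fixu Dx].
- move=> Exy j i; apply/eqP; rewrite -subr_eq0; apply/eqP.
  pose f j i v := (-1) *: fs j (y j i) v + fs j (x j i) v.
  have [_ <-] := fsP j _ (Dx j i); have [_ <-] := fsP j _ (Dy j i).
  rewrite addrC -scaleN1r; apply: (hom_family_independent (f := f)) => [j1 i1|].
    have [[l1 H1] _] := fsP j1 _ (Dx j1 i1); have [[l2 H2] _] := fsP j1 _ (Dy j1 i1).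
    split=> [b v z|h v hS]; rewrite /f.
      by rewrite l1 l2 !scalerDr !scalerA mulrC addrACA.
    by rewrite H1 // H2 // phi_lin.
  transitivity ((-1) *: Phi y + Phi x); last by rewrite Exy scaleN1r addNr.
  rewrite /Phi scaler_sumr -big_split; apply: eq_bigr => j1 _ /=.
  by rewrite scaler_sumr -big_split.
- have [x0 <-] := orbit_hom_surj m; have [lO OA] := orbit_hom_hom m.
  move: x0; apply: (tga_semisimple stab_setP alpha_stab_neq0 complA regular_tga_mod).
    split=> [|a x1 x2 [X1 [D1 E1]] [X2 [D2 E2]]].
      exists (fun _ _ => 0); split=> [j i|]; first by case: (sL j).
      rewrite linmap0 // /Phi big1 // => j _; apply: big1 => i _.
      by apply: (fs_unique j _ (fun=> 0)) => //; split=> [a x y|h x hS];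
        rewrite ?scaler0 ?addr0 // linmap0 //; apply: phi_lin.
    exists (fun j i => a *: X1 j i + X2 j i); split=> [j i|].
      by case: (sL j) => _; apply.
    by rewrite Phi_lin // E1 E2 lO.
  move=> j X XP y; pose F v := orbit_hom m (v *m X).
  have [lF FA] : tga_hom GM phi (A j) F.
    split=> [a v1 v2|h v hS]; first by rewrite /F mulmxDl -scalemxAl lO.
    by rewrite /F -mulmxA XP // mulmxA OA.
  (* The preimage of [F y] has entries [y_i F (w j)] in block [j] and 0 elsewhere: the homomorphism
     attached to [y_i F (w j)] is [y_i F]. *)
  have /fin_all_exists2[x Dx xE] j' : exists2 x : 'I_(n j') -> M,
      forall i, Mlam GM phi (A j') (w j') (x i) &
      \sum_i fs j' (x i) (delta_mx 0 i) = if j' == j then F y else 0.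
    have [->|neq_j] := eqVneq j' j.
      exists (fun i => y 0 i *: F (w j)) => [i|].
        by apply: subspaceZ => //; exists F.
      rewrite [y in RHS]row_sum_delta (linmap_sum _ _ _ lF); apply: eq_bigr => i _.
      rewrite (linmapZ _ _ lF); apply: (fs_unique j _ (fun v => y 0 i *: F v)) => //.
      split=> [b v1 v2|h v hS]; first by rewrite lF scalerDr !scalerA mulrC.
      by rewrite FA // (linmapZ _ _ (phi_lin hS)).
    exists (fun=> 0) => [i|]; first by case: (sL j').
    apply: big1 => i _; apply: (fs_unique j' _ (fun=> 0)) => //.
    by split=> [b v1 v2|h v hS]; rewrite ?scaler0 ?addr0 // linmap0 //; apply: phi_lin.
  exists x; split=> //; rewrite /Phi (eq_bigr _ (fun j' _ => xE j')) -big_mkcond.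
  by rewrite big_pred1_eq.
- rewrite /Phi (linmap_sum _ _ _ (phi_lin hS)); apply: eq_bigr => j _.
  rewrite (linmap_sum _ _ _ (phi_lin hS)).
  have fsH i := proj1 (fsP j _ (Dx j i)).
  transitivity (\sum_l \sum_i A j h i l *: fs j (x j i) (delta_mx 0 l)).
    apply: eq_bigr => l _.
    apply: (fs_unique j _ (fun v => \sum_i A j h i l *: fs j (x j i) v)).
      split=> [b v1 v2|h' v hS'].
        rewrite scaler_sumr -big_split; apply: eq_bigr => i _ /=.
        by have [-> _] := fsH i; rewrite scalerDr !scalerA mulrC.
      rewrite (linmap_sum _ _ _ (phi_lin hS')); apply: eq_bigr => i _.
      by have [_ ->] := fsH i; rewrite // (linmapZ _ _ (phi_lin hS')).
    by apply: eq_bigr => i _; have [_ ->] := fsP j _ (Dx j i).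
  rewrite exchange_big; apply: eq_bigr => i _ /=.
  have [lfs fsA] := fsH i; rewrite -fsA // -rowE [row _ _]row_sum_delta linmap_sum //.
  by apply: eq_bigr => l _; rewrite linmapZ // mxE.
- have lu := mode_linr irr_weak u q.
  rewrite /Phi (linmap_sum _ _ _ lu); apply: eq_bigr => j _.
  rewrite (linmap_sum _ _ _ lu); apply: eq_bigr => i _.
  have [[lfs fsA] fsw] := fsP j _ (Dx j i).
  apply: (fs_unique j _ (fun v => Ym u q (fs j (x j i) v))); last by rewrite fsw.
  split=> [|h v hS]; first exact: linmap_comp.
  by rewrite fsA // phi_mode // fixu //; apply: stab_in.
Qed.

End Decomposition.
End Orbifold.

Theorem theorem5p5 (R : realType)
    (V : lmodType (complex R)) (Y : V -> int -> V -> V) (one om : V)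
    (gT : finGroupType) (G : {group gT}) (act : gT -> V -> V) (g : gT)
    (M : lmodType (complex R)) (Ym : V -> int -> M -> M)
    (phi : gT -> M -> M) (alpha : gT -> gT -> complex R) :
  simple_VOA Y one om ->
  aut_group Y one om G act ->
  g \in 'Z(G)%g ->
  g_rational Y one om act g ->
  irreducible_twisted_module Y one om act g Ym ->
  (* phi(h), h in G_M *)
  (forall h, stab_mod act Ym G h -> phi_ok act Ym (phi h) h) ->
  (forall w, phi 1%g w = w) ->
  (* the 2-cocycle alpha_M:  phi(h) phi(k) = alpha_M(h,k) phi(hk) *)
  (forall h k, stab_mod act Ym G h -> stab_mod act Ym G k ->
     forall w, phi h (phi k w) = alpha h k *: phi (h * k)%g w) ->
  (* (1) each M_gamma is an irreducible V^G-module *)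
  (forall (n : nat) (A : gT -> 'M[complex R]_n),
     tga_simple (stab_mod act Ym G) alpha A ->
     forall w : 'rV[complex R]_n, w != 0 ->
       irreducible_on Ym (fixed_pts G act)
         (Mlam (stab_mod act Ym G) phi A w)) /\
  (* (2) M ~= (+)_lambda W_lambda (x) M_lambda as C^alpha[G_M] (x) V^G-modules;
     an element of (+)_lambda W_lambda (x) M_lambda is encoded as a family
     x j i in M_j (the coefficient of the i-th basis vector e_i of W_j). *)
  (forall (k : nat) (n : 'I_k -> nat)
          (A : forall j : 'I_k, gT -> 'M[complex R]_(n j))
          (w : forall j : 'I_k, 'rV[complex R]_(n j)),
     complete_simples (stab_mod act Ym G) alpha A ->
     (forall j, w j != 0) ->
     let D (x : forall j : 'I_k, 'I_(n j) -> M) :=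
       forall j i, Mlam (stab_mod act Ym G) phi (A j) (w j) (x j i) in
     exists Phi : (forall j : 'I_k, 'I_(n j) -> M) -> M,
       [/\ (forall (a : complex R) x y, D x -> D y ->
              Phi (fun j i => a *: x j i + y j i) = a *: Phi x + Phi y),
           (forall x y, D x -> D y -> Phi x = Phi y -> forall j i, x j i = y j i),
           (forall m, exists x, D x /\ Phi x = m),
           (forall h x, stab_mod act Ym G h -> D x ->
              Phi (fun j l => \sum_(i < n j) A j h i l *: x j i) = phi h (Phi x)) &
           (forall u (q : int) x, fixed_pts G act u -> D x ->
              Phi (fun j i => Ym u q (x j i)) = Ym u q (Phi x))]).
Proof.
move=> simpV autG gZ _ irrM phiP phi1 phiM.
split=> [n A simpA w w0|k n A w complA w0].
  exact: (Mlam_irreducible simpV autG gZ irrM phiP phi1 phiM simpA w0).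
exact: (isotypic_decomposition simpV autG gZ irrM phiP phi1 phiM complA w0).
Qed.
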